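(* Let $m$, $k$, $t$ be positive integers. Then: (i) the class of $mK_t$-free graphs is $(t-1)$-strongly Pollyanna; (ii) the class of $(t,k)$-pineapple-free graphs is $(2t-4)$-strongly Pollyanna; (iii) the class of $t$-lollipop-free graphs is $(3t-6)$-strongly Pollyanna; (iv) the class of bowtie-free graphs is $3$-strongly Pollyanna; (v) the class of bull-free graphs is $2$-strongly Pollyanna.
   Context: All graphs are finite and simple; $H$-free means no induced subgraph isomorphic to $H$; $\chi$ and $\omega$ denote chromatic and clique number. A class $\mathcal F$ of graphs is polynomially $\chi$-bounded if there is a polynomial $f$ with $\chi(H)\le f(\omega(H))$ for every induced subgraph $H$ of every graph in $\mathcal F$. For an integer $n$, $\chi^{(n)}(G)$ denotes the maximum chromatic number of an induced subgraph $H$ of $G$ with $\omega(H)\le n$. A class $\mathcal F$ of graphs is $n$-good if it is closed under taking induced subgraphs and there is a constant $c$ with $\chi^{(n)}(G)\le c$ for all $G\in\mathcal F$. A class $\mathcal C$ is $n$-strongly Pollyanna if $\mathcal C\cap\mathcal F$ is polynomially $\chi$-bounded for every $n$-good class $\mathcal F$. $mK_t$ is the disjoint union of $m$ copies of $K_t$. A $(t,k)$-pineapple is obtained from $K_t$ by attaching $k$ pendant edges at a single vertex of $K_t$. A $t$-lollipop is obtained from the disjoint union of $K_t$ and a path $P_2$ on two vertices by adding one edge between a vertex of the $K_t$ and a vertex of the $P_2$. A bowtie is obtained from two disjoint copies of $K_2$ by adding a new vertex adjacent to all four other vertices. A bull consists of a triangle $abc$ and two further vertices $d,e$ with $d$ adjacent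 only to $a$ and $e$ adjacent only to $b$. *)

(* Defs.v *)
From HB Require Import structures.
From mathcomp Require Import all_boot all_order all_algebra.

Set Implicit Arguments.
Unset Strict Implicit.
Unset Printing Implicit Defensive.

Import Order.TTheory GRing.Theory Num.Theory.

Record sgraph := SGraph {
  vertex :> finType;
  adj : rel vertex;
  adj_sym : symmetric adj;
  adj_irr : irreflexive adj
}.

Section Graph.
Variable G : sgraph.

Definition induced (A : {set G}) : sgraph :=
  @SGraph {x : G | x \in A} (fun x y => adj (val x) (val y))
    (fun x y => adj_sym (val x) (val y)) (fun x => adj_irr (val x)).

Definition clique (A : {set G}) : bool :=
  [forall x in A, forall y in A, (x != y) ==> adj x y].

Definition clique_number : nat := \max_(A : {set G} | clique A) #|A|.

Definition colorable (k : nat) : bool :=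
  [exists f : {ffun G -> 'I_k},
     [forall x, forall y, adj x y ==> (f x != f y)]].

Lemma colorable_card : exists k, colorable k.
Proof.
exists #|G|; apply/existsP; exists [ffun x => enum_rank x].
apply/forallP => x; apply/forallP => y; apply/implyP => xy.
rewrite !ffunE (inj_eq enum_rank_inj); apply: contraTneq xy => ->.
by rewrite adj_irr.
Qed.

Definition chromatic_number : nat := ex_minn colorable_card.

End Graph.

(* [n] ranges over all integers; for [n < 0] there is no induced subgraph to
   consider and the maximum is 0. *)
Definition chi_upto (n : int) (G : sgraph) : nat :=
  \max_(A : {set G} | ((clique_number (induced A))%:Z <= n)%R)
     chromatic_number (induced A).

Definition iso (G H : sgraph) : Prop :=
  exists2 f : G -> H, bijective f & forall x y, adj (f x) (f y) = adj x y.

(* Not required to be closed under isomorphism. *)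
Definition graph_class := sgraph -> Prop.

Definition induced_free (H : sgraph) : graph_class :=
  fun G => forall A : {set G}, ~ iso (induced A) H.

Definition hereditary (F : graph_class) : Prop :=
  forall (G : sgraph) (A : {set G}), F G -> F (induced A).

Definition poly_chi_bounded (F : graph_class) : Prop :=
  exists f : {poly int}, forall (G : sgraph) (A : {set G}), F G ->
    ((chromatic_number (induced A))%:Z
       <= f.[(clique_number (induced A))%:Z])%R.

Definition good (n : int) (F : graph_class) : Prop :=
  hereditary F /\ exists c : nat, forall G, F G -> chi_upto n G <= c.

Definition strongly_pollyanna (n : int) (C : graph_class) : Prop :=
  forall F : graph_class, good n F ->
    poly_chi_bounded (fun G => C G /\ F G).

Section DisjointCliques.
Variables m t : nat.

Definition mK_adj : rel ('I_m * 'I_t) :=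
  fun x y => (x.1 == y.1) && (x.2 != y.2).

Lemma mK_sym : symmetric mK_adj.
Proof. by move=> x y; rewrite /mK_adj eq_sym [x.2 == _]eq_sym. Qed.

Lemma mK_irr : irreflexive mK_adj.
Proof. by move=> x; rewrite /mK_adj !eqxx. Qed.

Definition mK : sgraph := SGraph mK_sym mK_irr.

End DisjointCliques.

Section Pineapple.
Variables t k : nat.

(* All pendant edges are attached at vertex 0 of K_t. *)
Definition pineapple_adj : rel ('I_t + 'I_k) := fun x y =>
  match x, y with
  | inl i, inl j => i != j
  | inl i, inr _ | inr _, inl i => val i == 0
  | inr _, inr _ => false
  end.

Lemma pineapple_sym : symmetric pineapple_adj.
Proof. by case=> i [] j //=; rewrite eq_sym. Qed.

Lemma pineapple_irr : irreflexive pineapple_adj.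
Proof. by case=> i //=; rewrite eqxx. Qed.

Definition pineapple : sgraph := SGraph pineapple_sym pineapple_irr.

End Pineapple.

Section Lollipop.
Variable t : nat.

(* The edge added between K_t and P_2 joins vertex 0 of each. *)
Definition lollipop_adj : rel ('I_t + 'I_2) := fun x y =>
  match x, y with
  | inl i, inl j => i != j
  | inl i, inr j | inr j, inl i => (val i == 0) && (val j == 0)
  | inr i, inr j => i != j
  end.

Lemma lollipop_sym : symmetric lollipop_adj.
Proof. by case=> i [] j //=; rewrite eq_sym. Qed.

Lemma lollipop_irr : irreflexive lollipop_adj.
Proof. by case=> i //=; rewrite eqxx. Qed.

Definition lollipop : sgraph := SGraph lollipop_sym lollipop_irr.

End Lollipop.

Definition bowtie_adj : rel (option (mK 2 2)) := fun x y =>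
  match x, y with
  | Some u, Some v => adj u v
  | None, None => false
  | _, _ => true
  end.

Lemma bowtie_sym : symmetric bowtie_adj.
Proof. by case=> [u|] [v|] //=; apply: mK_sym. Qed.

Lemma bowtie_irr : irreflexive bowtie_adj.
Proof. by case=> [u|] //=; apply: mK_irr. Qed.

Definition bowtie : sgraph := SGraph bowtie_sym bowtie_irr.

(* a, b, c, d, e are 0, 1, 2, 3, 4. *)
Definition bull_edges : seq (nat * nat) :=
  [:: (0, 1); (0, 2); (1, 2); (0, 3); (1, 4)].

Definition bull_adj : rel 'I_5 := fun x y =>
  ((val x, val y) \in bull_edges) || ((val y, val x) \in bull_edges).

Lemma bull_sym : symmetric bull_adj.
Proof. by move=> x y; rewrite /bull_adj orbC. Qed.

Lemma bull_irr : irreflexive bull_adj.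
Proof. by case; do 5?[case=> //]. Qed.

Definition bull : sgraph := SGraph bull_sym bull_irr.

(* Main.v *)
Require Import Defs.
From HB Require Import structures.
From mathcomp Require Import all_boot all_order all_algebra.
From mathcomp Require Import zify.

Set Implicit Arguments.
Unset Strict Implicit.
Unset Printing Implicit Defensive.

Import Order.TTheory GRing.Theory Num.Theory.

(** Fix a maximum clique [K]; every vertex has a non-neighbour in [K].

    (i) Vertices with at least [t] non-neighbours in [K] miss a [t]-subset of
    [K], so induction on [m] applies to them; the others are grouped by their
    fewer than [t] non-neighbours, and each group has clique number below [t].

    (ii), (iv) Neighbourhoods are coloured by (i).  One repeatedly removes a
    suitable set [B] around a small clique, so that a vertex of [B] has few
    (pineapple) or only pairwise non-adjacent (bowtie) neighbours left; the
    colourings of the successive [B]'s can then be combined.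

    (iii) If there are two anticomplete large cliques [K] and [C], with [K] as
    large as possible, the set [X] of vertices with a neighbour in each is
    complete to [K] and nothing outside [X] has a clique larger than [K]; thus
    [om X + om (A :\: X) <= om A] and a superadditive bound follows by
    induction.  Otherwise (i) applies with [m = 2].

    (v) Polynomial bounds survive substitution, so the graph may be assumed
    prime.  In a prime bull-free graph a set with adjacent centre and
    anticentre has only split graphs as prime induced subgraphs.  The sets of
    non-neighbours in [K] take polynomially many values, which bounds the
    chromatic number of the vertices touching [K].  Remove these and iterate:
    vertices with the same colour and the same size of [K] span no triangle. *)

(** * Clique numbers and colourings of vertex subsets *)

Lemma leq_expl a b e : a <= b -> a ^ e <= b ^ e.
Proof. by case: e => [|e] ab; rewrite ?expn0 ?leq_exp2r. Qed.

Section Basics.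
Variable G : sgraph.
Implicit Types (x y z : G) (A B K : {set G}).

(** [om] and [setcol] describe the subgraph induced on [A] from inside the ambient graph, so that no
    induction has to form induced subgraphs of induced subgraphs. Colourings are defined on all of
    [G], which lets them be merged by cases. *)
Definition om A := \max_(K : {set G} | (K \subset A) && clique K) #|K|.

Definition setcol A n := exists2 f : G -> nat, {in A, forall x, f x < n}
  & {in A &, forall x y, adj x y -> f x <> f y}.

Lemma cliqueP A :
  reflect {in A &, forall x y, x != y -> adj x y} (clique A).
Proof.
apply: (iffP forall_inP) => [h x y xA yA xy|h x xA].
  by have /forall_inP/(_ y yA)/implyP := h x xA; apply.
by apply/forall_inP => y yA; apply/implyP; apply: h.
Qed.

Lemma clique_sub A B : A \subset B -> clique B -> clique A.
Proof.
move=> /subsetP AB /cliqueP h; apply/cliqueP => x y /AB xB /AB yB.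
exact: h.
Qed.

Lemma clique0 : clique (set0 : {set G}).
Proof. by apply/cliqueP => x y; rewrite inE. Qed.

Lemma clique1 x : clique [set x].
Proof. by apply/cliqueP => y z /set1P-> /set1P->; rewrite eqxx. Qed.

Lemma cliqueU A B : clique A -> clique B ->
  {in A & B, forall x y, adj x y} -> clique (A :|: B).
Proof.
move=> /cliqueP cA /cliqueP cB AB; apply/cliqueP => x y.
by case/setUP=> xA /setUP[] yA ne; [apply: cA|apply: AB|rewrite adj_sym; apply: AB|apply: cB].
Qed.

Lemma adj_neq x y : adj x y -> x != y.
Proof. by apply: contraTneq => ->; rewrite adj_irr. Qed.

Lemma clique_card_le_om A K : K \subset A -> clique K -> #|K| <= om A.
Proof.
move=> KA cK; apply: (@leq_bigmax_cond _ _ (fun K : {set G} => #|K|) K).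
by rewrite KA.
Qed.

Lemma om_witness A : exists K, [/\ K \subset A, clique K & #|K| = om A].
Proof.
have P0 : (set0 \subset A) && clique (set0 : {set G}) by rewrite sub0set clique0.
rewrite /om (bigop.bigmax_eq_arg set0) //.
by case: arg_maxnP => // K /andP[? ?] _; exists K.
Qed.

Lemma om_leP A n :
  reflect (forall K, K \subset A -> clique K -> #|K| <= n) (om A <= n).
Proof.
apply: (iffP idP) => [h K KA cK|h].
  exact: leq_trans (clique_card_le_om KA cK) h.
by have [K [KA cK <-]] := om_witness A; apply: h.
Qed.

Lemma om_sub A B : A \subset B -> om A <= om B.
Proof.
move=> AB; apply/om_leP => K KA cK; apply: clique_card_le_om => //.
exact: subset_trans AB.
Qed.

Lemma om_gt0 x A : x \in A -> 0 < om A.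
Proof.
by move=> xA; rewrite -(cards1 x) clique_card_le_om ?sub1set ?clique1.
Qed.

Lemma om_eq0 A : om A = 0 -> A = set0.
Proof.
move=> A0; apply/eqP/set0Pn => -[x /om_gt0]; by rewrite A0.
Qed.

Lemma col_sub A B m n : A \subset B -> m <= n -> setcol B m -> setcol A n.
Proof.
move=> /subsetP AB mn [f fl fp]; exists f => [x /AB/fl xf|x y /AB xB /AB yB].
  exact: leq_trans xf mn.
exact: fp.
Qed.

Lemma col_set0 n : setcol set0 n.
Proof. by exists (fun=> 0) => x; rewrite inE. Qed.

Lemma col_card A : setcol A #|A|.
Proof.
exists (fun x => index x (enum A)) => [x xA|x y xA yA xy].
  by rewrite cardE index_mem mem_enum.
move=> /(congr1 (nth x (enum A))); rewrite !nth_index ?mem_enum // => e.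
by move: xy; rewrite e adj_irr.
Qed.

Lemma colU A B m n : setcol A m -> setcol B n -> setcol (A :|: B) (m + n).
Proof.
move=> [f fl fp] [g gl gp].
exists (fun x => if x \in A then f x else m + g x) => [x|x y].
  rewrite inE; case: ifP => [xA _|_ /= xB]; first exact/ltn_addr/fl.
  by rewrite ltn_add2l gl.
rewrite !inE; case: ifP => xA; case: ifP => yA //= xB yB.
- exact: fp.
- by move: (fl x xA) => h _ e; move: h; rewrite e ltnNge leq_addr.
- by move: (fl y yA) => h _ e; move: h; rewrite -e ltnNge leq_addr.
- by move=> xy /addnI; apply: gp.
Qed.

Lemma col_bigcup (I : finType) (P : {set I}) (F : I -> {set G}) k :
  {in P, forall i, setcol (F i) k} -> setcol (\bigcup_(i in P) F i) (#|P| * k).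
Proof.
move=> h; rewrite -sum_nat_const -!big_enum /=.
have: {subset enum P <= P} by move=> i; rewrite mem_enum.
elim: (enum P) => [|i s IHs] sP; first by rewrite !big_nil; apply: col_set0.
rewrite !big_cons; apply: colU.
  by apply: h; apply: sP; rewrite mem_head.
by apply: IHs => j js; apply: sP; rewrite inE js orbT.
Qed.

Lemma col_classes A (g : G -> nat) N k : {in A, forall x, g x < N} ->
  (forall i, setcol [set x in A | g x == i] k) -> setcol A (N * k).
Proof.
move=> gN h.
have := @col_bigcup 'I_N setT (fun i => [set x in A | g x == i]) k.
rewrite cardsT card_ord => /(_ (fun i _ => h i)); apply: col_sub => //.
apply/subsetP => x xA; apply/bigcupP; exists (Ordinal (gN x xA)) => //.
by rewrite !inE xA /=.
Qed.

Lemma card_bigcup_le (T I : finType) (P : {set I}) (F : I -> {set T}) a :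
  {in P, forall i, #|F i| <= a} -> #|\bigcup_(i in P) F i| <= #|P| * a.
Proof.
move=> h; rewrite -sum_nat_const.
elim/big_ind2: _ => [|B m C n Bm Cn|i /h //]; first by rewrite cards0.
by rewrite cardsU (leq_trans (leq_subr _ _)) ?leq_add.
Qed.

Lemma card_col A n a : setcol A n ->
  (forall I : {set G}, I \subset A -> {in I &, forall x y, ~~ adj x y} ->
     #|I| <= a) ->
  #|A| <= n * a.
Proof.
move=> [f fl fp] h.
have -> : A = \bigcup_(i in [set: 'I_n]) [set x in A | f x == i].
  apply/setP => x; apply/idP/bigcupP => [xA|[i _]]; last by rewrite inE => /andP[].
  by exists (Ordinal (fl x xA)); rewrite ?inE ?xA /=.
rewrite -[X in _ <= X * a](card_ord n) -cardsT; apply: card_bigcup_le => i _; apply: h.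
  by apply/subsetP => x; rewrite inE => /andP[].
move=> x y; rewrite !inE => /andP[xA /eqP ex] /andP[yA /eqP ey].
by apply/negP => /(fp x y xA yA); rewrite ex ey.
Qed.

Lemma col_om0 A : om A <= 0 -> setcol A 0.
Proof. by rewrite leqn0 => /eqP/om_eq0->; apply: col_set0. Qed.

(** A vertex of [A] adjacent to all of [K] would enlarge it; a vertex of [K] is its own
    non-neighbour. *)
Lemma max_clique_nonadj A K : K \subset A -> clique K -> #|K| = om A ->
  {in A, forall x, exists2 u, u \in K & ~~ adj u x}.
Proof.
move=> KA cK Kw x xA.
have [/exists_inP //|] := boolP [exists u in K, ~~ adj u x].
rewrite negb_exists_in => /forall_inP h; exfalso.
have xK : x \notin K.
  by apply/negP => /h; rewrite adj_irr.
have: #|x |: K| <= om A.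
  apply: clique_card_le_om; first by rewrite subUset sub1set xA.
  apply: cliqueU (clique1 x) cK _ => _ u /set1P-> /h.
  by rewrite negbK adj_sym.
by rewrite cardsU1 xK Kw ltnn.
Qed.
End Basics.

(** A subset of size at most [t] arises from [t] choices, each adding a vertex ([Some x]) or nothing
    ([None]), hence [#|K|.+1] options per choice. *)
Lemma card_small_subsets (T : finType) (K : {set T}) t :
  #|[set S : {set T} | (S \subset K) && (#|S| <= t)]| <= #|K|.+1 ^ t.
Proof.
elim: t => [|t IHt].
  rewrite expn0 -(cards1 (set0 : {set T})); apply/subset_leq_card/subsetP => S.
  by rewrite !inE leqn0 cards_eq0 => /andP[].
pose F (o : option T) : {set {set T}} :=
  [set (if o is Some x then x |: S else S)
     | S in [set S : {set T} | (S \subset K) && (#|S| <= t)]].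
pose P := None |: [set Some x | x in K].
have cP : #|P| = #|K|.+1.
  rewrite cardsU1 card_imset; last by move=> x y [].
  suff -> : None \notin [set Some x | x in K] by [].
  by apply/imsetP => -[].
rewrite expnS -{1}cP.
apply: (@leq_trans #|\bigcup_(o in P) F o|); last first.
  apply: card_bigcup_le => o _; apply: leq_trans (leq_imset_card _ _) IHt.
apply/subset_leq_card/subsetP => S; rewrite inE => /andP[SK St].
have [->|[x xS]] := set_0Vmem S.
  apply/bigcupP; exists None; first by rewrite setU11.
  by apply/imsetP; exists set0 => //; rewrite inE sub0set cards0.
apply/bigcupP; exists (Some x).
  by apply/setU1P; right; apply: imset_f; apply: (subsetP SK).
apply/imsetP; exists (S :\ x); last by rewrite setD1K.
rewrite inE (subset_trans (subsetDl _ _) SK) /=.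
by move: St; rewrite (cardsD1 x) xS.
Qed.

(** * From vertex subsets to induced subgraphs *)

Section Links.
Variable G : sgraph.
Implicit Types (A : {set G}).

Lemma colorable_col A n : colorable (induced A) n <-> setcol A n.
Proof.
split=> [/existsP[f /forallP fp]|[f fl fp]].
  exists (fun x => if insub x is Some u then val (f u) else 0) => [x xA|x y xA yA xy].
    by rewrite insubT /=.
  rewrite !insubT /= => /val_inj e.
  by move: (fp (Sub x xA)) => /forallP/(_ (Sub y yA))/implyP/(_ xy); rewrite e eqxx.
apply/existsP; exists [ffun u : induced A => Ordinal (fl (val u) (valP u))].
apply/forallP => x; apply/forallP => y; apply/implyP => xy; rewrite !ffunE.
apply/eqP => /(congr1 val) /=; apply: fp xy; exact: valP.
Qed.

Lemma clique_number_om A : clique_number (induced A) = om A.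
Proof.
apply/eqP; rewrite eqn_leq; apply/andP; split.
  apply/bigmax_leqP => K cK; rewrite -(card_imset _ val_inj).
  apply: clique_card_le_om.
    by apply/subsetP => _ /imsetP[u _ ->]; apply: valP.
  apply/cliqueP => _ _ /imsetP[u uK ->] /imsetP[v vK ->] ne.
  move/cliqueP: cK => /(_ u v uK vK); apply.
  by apply: contraNneq ne => ->.
apply/om_leP => K /subsetP KA cK.
have -> : K = val @: [set u : induced A | val u \in K].
  apply/setP => x; apply/idP/imsetP => [xK|[u]]; last by rewrite inE => ? ->.
  by exists (Sub x (KA x xK)); rewrite ?inE.
rewrite card_imset; last exact: val_inj.
apply: (@leq_bigmax_cond _ _ (fun K : {set induced A} => #|K|)).
apply/cliqueP => u v; rewrite !inE => uK vK ne.
by move/cliqueP: cK => /(_ _ _ uK vK); apply; rewrite (inj_eq val_inj).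
Qed.

Lemma chromatic_number_le A n : setcol A n -> chromatic_number (induced A) <= n.
Proof.
by move=> /colorable_col cn; rewrite /chromatic_number; case: ex_minnP => k _; apply.
Qed.

Lemma col_chromatic A : setcol A (chromatic_number (induced A)).
Proof. by apply/colorable_col; rewrite /chromatic_number; case: ex_minnP. Qed.

Lemma induced_freeE (H : sgraph) : induced_free H G ->
  forall f : H -> G, injective f ->
    ~ (forall x y, adj (f x) (f y) = adj x y).
Proof.
move=> free f fi fa.
apply: (free (f @: setT)).
have fT (u : induced (f @: setT)) : val u \in codom f.
  by have /imsetP[x _ ->] := valP u; apply: codom_f.
pose g (u : induced (f @: setT)) := iinv (fT u).
have fg u : f (g u) = val u by rewrite /g f_iinv.
exists g => [|x y]; last by rewrite -fa !fg.
exists (fun x => Sub (f x) (imset_f f (in_setT x))) => [u|x].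
  by apply: val_inj; rewrite /= fg.
by apply: fi; rewrite fg.
Qed.
End Links.

Lemma good_col n F : good n F ->
  exists c, forall G, F G -> forall A : {set G}, ((om A)%:Z <= n)%R -> setcol A c.
Proof.
move=> [_ [c hc]]; exists c => G FG A An.
apply: col_sub (col_chromatic A) => //; apply: leq_trans (hc G FG).
apply: (@leq_bigmax_cond _ _ (fun A : {set G} => chromatic_number (induced A))).
by rewrite clique_number_om.
Qed.

(** All five parts deliver their bound in this form. The base [(om A).+1] is positive, so
    lower-order terms can be absorbed into the power. *)
Lemma poly_chi_bounded_of_col (F : graph_class) C e :
  (forall G, F G -> forall A : {set G}, setcol A (C * (om A).+1 ^ e)) ->
  poly_chi_bounded F.
Proof.
move=> h; exists (C%:R%:P * ('X + 1) ^+ e)%R => G A FG.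
have := chromatic_number_le (h G FG A); rewrite clique_number_om.
rewrite hornerM horner_exp hornerD hornerX !hornerC.
move=> le; apply: (@le_trans _ _ (C * (om A).+1 ^ e)%N%:Z%R); first by rewrite lez_nat.
by rewrite PoszM -!natz natrX -natr1.
Qed.

(** * Disjoint unions of cliques *)

Lemma exists_subset_card (T : finType) (A : {set T}) n : n <= #|A| ->
  exists2 B : {set T}, B \subset A & #|B| = n.
Proof.
move=> nA; exists [set x in take n (enum A)].
  by apply/subsetP => x; rewrite inE => /mem_take; rewrite mem_enum.
rewrite cardsE (card_uniqP _) ?take_uniq ?enum_uniq // size_take -cardE.
by case: ltngtP nA.
Qed.

Section DisjointCliques.
Variable G : sgraph.
Implicit Types (x y z : G) (A B K S I : {set G}).

Definition stable I := {in I &, forall x y, ~~ adj x y}.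

Definition anti S := [set x | (x \notin S) && [forall u in S, ~~ adj u x]].

Lemma antiP S x : reflect (x \notin S /\ {in S, forall u, ~~ adj u x}) (x \in anti S).
Proof. by rewrite inE; apply: (iffP andP) => -[xS /forall_inP]. Qed.

(** A copy of [mK_t] as cliques picked one after another, each outside and anticomplete to the
    earlier ones, to suit induction on [m]. *)
Fixpoint has_mK (t m : nat) A : Prop :=
  if m is m'.+1 then
    exists S, [/\ S \subset A, clique S, #|S| = t & has_mK t m' (A :&: anti S)]
  else True.

Lemma col_mK_free t c : 0 < t -> (forall A, om A < t -> setcol A c) ->
  forall m A, ~ has_mK t m A -> setcol A (m * c.+1 * (om A).+1 ^ (t * m)).
Proof.
move=> t0 hc; elim=> [A []//|m IHm A hA].
have [K [KA cK Kw]] := om_witness A.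
pose w := om A.
pose nn x := [set u in K | ~~ adj u x].
pose Fam := [set S : {set G} | (S \subset K) && (#|S| <= t)].
(* If [#|S| = t], then [S] followed by [m] cliques in [F S] would be forbidden, so induction applies
   to [F S]. A smaller [S] collects the vertices whose non-neighbours in [K] are exactly [S]. *)
pose F S := if #|S| == t then A :&: anti S else [set x in A | nn x == S].
have colF S : S \in Fam -> setcol (F S) (m * c.+1 * w.+1 ^ (t * m) + c).
  rewrite inE => /andP[SK St]; rewrite /F; case: eqP => [eS|/eqP nS].
    apply: col_sub (subxx _) _ (IHm (A :&: anti S) _); last first.
      move=> h; apply: hA; exists S; split=> //; first exact: subset_trans KA.
      exact: clique_sub cK.
    rewrite (leq_trans _ (leq_addr _ _)) // leq_mul2l leq_expl ?orbT //.
    by rewrite ltnS om_sub // subsetIl.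
  apply: col_sub (subxx _) (leq_addl _ _) (hc _ _).
  apply: (@leq_ltn_trans #|S|); last by rewrite ltn_neqAle nS.
  apply/om_leP => L /subsetP LF cL.
  (* A clique [L] of such a class is complete to [K :\: S]. Their union is no larger than [K], so
     [L] has at most [#|S| < t] vertices. *)
  have LU : {in L & K :\: S, forall x u, adj x u}.
    move=> x u /LF; rewrite !inE => /andP[xA /eqP<-] /andP[].
    by rewrite inE => + uK; rewrite uK /= negbK adj_sym.
  have disj : [disjoint L & K :\: S].
    apply/pred0P => x; apply/negP => /= /andP[xL xK].
    by have := LU x x xL xK; rewrite adj_irr.
  have: #|L :|: K :\: S| <= om A.
    apply: clique_card_le_om.
      rewrite subUset (subset_trans (subsetDl _ _) KA) andbT.
      by apply/subsetP => x /LF; rewrite inE => /andP[].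
    by apply: cliqueU cL _ LU; apply: clique_sub cK; apply: subsetDl.
  move: disj; rewrite -leq_card_setU => /eqP ->.
  by have := cardsID S K; rewrite (setIidPr SK) -Kw; lia.
(* [K] is coloured apart, since the vertices of [S] are excluded from [anti S]. *)
have AF : A \subset K :|: \bigcup_(S in Fam) F S.
  apply/subsetP => x xA; rewrite inE; have [//|xK /=] := boolP (x \in K).
  apply/bigcupP.
  have [lt|ge] := ltnP #|nn x| t.
    exists (nn x).
      by rewrite inE (ltnW lt) andbT; apply/subsetP => u; rewrite inE => /andP[].
    by rewrite /F (ltn_eqF lt) inE xA eqxx.
  have [S Sn eS] := exists_subset_card ge.
  have SK : S \subset K.
    by apply: subset_trans Sn _; apply/subsetP => u; rewrite inE => /andP[].
  exists S; first by rewrite inE SK eS leqnn.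
  rewrite /F eS eqxx inE xA; apply/antiP; split.
    by apply: contra xK => /(subsetP SK).
  by move=> u /(subsetP Sn); rewrite inE => /andP[].
apply: col_sub AF _ (colU (col_card K) (col_bigcup colF)).
have := card_small_subsets K t; rewrite -/Fam Kw -/w => hF.
(* The [w] colours of [K] are at most [w.+1 ^ t]; having [c.+1] in place of [c] pays for them. *)
apply: (@leq_trans (w + w.+1 ^ t * (m * c.+1 * w.+1 ^ (t * m) + c))).
  by rewrite leq_add2l leq_mul2r hF orbT.
have wt : w <= w.+1 ^ t.
  by apply: leq_trans (leqnSn w) _; rewrite -{1}(expn1 w.+1) leq_pexp2l.
have m1 : 0 < w.+1 ^ (t * m) by rewrite expn_gt0.
rewrite [t * m.+1]mulnS expnD; move: wt m1; rewrite -/w.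
move: (w.+1 ^ t) (w.+1 ^ (t * m)) => a b; nia.
Qed.

Lemma has_mK_stable t m A : 0 < t -> has_mK t m A ->
  exists I, [/\ I \subset A, stable I & #|I| = m].
Proof.
move=> t0; elim: m A => [|m IHm] A /=.
  by exists set0; split; [apply: sub0set|move=> x y; rewrite inE|apply: cards0].
move=> [S [SA cS St /IHm[I [IA sI Im]]]].
have /card_gt0P[u uS] : 0 < #|S| by rewrite St.
have uI x : x \in I -> x \notin S /\ ~~ adj u x.
  by move=> /(subsetP IA)/setIP[_ /antiP[xS /(_ u uS)]].
exists (u |: I); split.
- by rewrite subUset sub1set (subsetP SA) // (subset_trans IA) // subsetIl.
- move=> x y /setU1P[->|xI] /setU1P[->|yI]; rewrite ?adj_irr //.
  + by case: (uI y yI).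
  + by rewrite adj_sym; case: (uI x xI).
  + exact: sI.
- rewrite cardsU1 Im; suff -> : u \notin I by [].
  by apply/negP => /uI[/negP].
Qed.

(** A polynomial Ramsey bound: this is the case [t = 1], [c = 0] of [col_mK_free], with at most [k]
    vertices in each colour class. *)
Lemma card_no_stable k A :
  (forall I, I \subset A -> stable I -> #|I| <> k) ->
  #|A| <= k * (om A).+1 ^ k * k.
Proof.
move=> h.
have c0 B : om B < 1 -> setcol B 0 by rewrite ltnS; apply: col_om0.
have nK : ~ has_mK 1 k A.
  by move=> /has_mK_stable[] // I [IA sI]; apply: h.
have := col_mK_free (ltn0Sn 0) c0 nK; rewrite muln1 mul1n => /card_col; apply.
move=> I IA sI; rewrite leqNgt; apply/negP => lt.
have [J JI Jk] := exists_subset_card (ltnW lt).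
apply: (h J) => //; first exact: subset_trans IA.
by move=> x y /(subsetP JI) xI /(subsetP JI); apply: sI.
Qed.

Lemma has_mK_embedding t m A : has_mK t m A ->
  exists f : mK m t -> G, [/\ injective f, forall u, f u \in A
    & forall u v, adj (f u) (f v) = adj u v].
Proof.
elim: m A => [|m IHm] A /=.
  move=> _; have no (u : mK 0 t) : False by case: u => -[].
  by exists (fun u => match no u with end); split=> u; case: (no u).
move=> [S [SA cS St /IHm[f [fi fA fa]]]].
pose g (u : mK m.+1 t) : G :=
  if unlift ord0 u.1 is Some i then f (i, u.2)
  else enum_val (cast_ord (esym St) u.2).
have gS u j : f u \notin S /\ ~~ adj (enum_val (cast_ord (esym St) j)) (f u).
  have /setIP[_ /antiP[fS fn]] := fA u; split=> //; apply: fn; exact: enum_valP.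
have g0 j : enum_val (cast_ord (esym St) j) \in S by apply: enum_valP.
have gi j k : enum_val (cast_ord (esym St) j) = enum_val (cast_ord (esym St) k) -> j = k.
  by move/enum_val_inj/cast_ord_inj.
exists g; split.
- move=> [i j] [i' j']; rewrite /g /=.
  case: unliftP => [k ->|->]; case: unliftP => [k' ->|->] //=.
  + by move/fi=> [-> ->].
  + by move=> e; have [/negP[]] := gS (k, j) j'; rewrite e.
  + by move=> e; have [/negP[]] := gS (k', j') j; rewrite -e.
  + by move/gi ->.
- move=> [i j]; rewrite /g /=; case: unliftP => [k _|_].
    by have /setIP[] := fA (k, j).
  exact: (subsetP SA).
- move=> [i j] [i' j']; rewrite /g /= /mK_adj /=.
  case: unliftP => [k ->|->]; case: unliftP => [k' ->|->] //=.
  + by have [_ /negPf] := gS (k, j) j'; rewrite adj_sym.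
  + by have [_ /negPf] := gS (k', j') j.
  + apply/idP/idP => [|ne].
      by apply: contraTneq => ->; rewrite adj_irr.
    move/cliqueP: cS; apply=> //.
    by apply: contraNneq ne => /gi ->.
Qed.
End DisjointCliques.

Lemma strongly_pollyanna_mK m t : 0 < t ->
  strongly_pollyanna (t%:Z - 1)%R (induced_free (mK m t)).
Proof.
move=> t0 F /good_col[c hc].
apply: (@poly_chi_bounded_of_col _ (m * c.+1) (t * m)) => G [free FG] A.
apply: col_mK_free => // [B Bt|].
  by apply: hc => //; lia.
by move=> /has_mK_embedding[f [fi _ fa]]; apply: (induced_freeE free fi).
Qed.

(** * Pineapples *)

Lemma exists_avoiding (s : seq nat) n : size s < n ->
  exists2 d, d < n & d \notin s.
Proof.
move=> sn; have [/hasP[d]|] := boolP (has (fun d => d \notin s) (iota 0 n)).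
  by rewrite mem_iota add0n => dn ds; exists d.
rewrite -all_predC => /allP h; move: sn; rewrite ltnNge => /negP[].
rewrite -{1}(size_iota 0 n); apply: uniq_leq_size; first exact: iota_uniq.
by move=> d /h /=; rewrite negbK.
Qed.

Section Pineapple.
Variable G : sgraph.
Implicit Types (x y z u v : G) (A B K S T I R U Y Z : {set G}).

(** [v] carries the pendant edges and [T] is the rest of the clique, so [s] stands for [t - 1]. *)
Definition pineapple_free_in s k := forall v T I, clique T -> #|T| = s ->
  {in T, forall u, adj v u} -> stable I -> #|I| = k ->
  {in I, forall u, adj v u} ->
  ~ {in T & I, forall u x, u != x /\ ~~ adj u x}.

(* A vertex of [B] gets a pair: its colour in [B] and a residue that avoids
   those of its at most [P] remaining neighbours. *)
Lemma setcol_peel R B Q P : B \subset R -> setcol B Q ->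
  forall U, U \subset R :\: B ->
  {in B, forall x, #|[set y in R :\: B | adj x y]| <= P} ->
  setcol (R :\: B :\: U) (Q * P.+1) -> setcol (R :\: U) (Q * P.+1).
Proof.
move=> BR [k kQ kp] U URB hP [f fQ fp].
have /fin_all_exists[d dP] : forall x, exists d, x \in B -> d < P.+1 /\
    {in R :\: B :\: U, forall y, adj x y -> d <> f y %% P.+1}.
  move=> x; have [xB|_] := boolP (x \in B); last by exists 0.
  pose s := [seq f y %% P.+1 | y <- enum [set y in R :\: B | adj x y]].
  have [|d dP ds] := @exists_avoiding s P.+1.
    by rewrite size_map -cardE ltnS hP.
  exists d => _; split=> // y yR xy dE; move/negP: ds; apply.
  apply/mapP; exists y => //; rewrite mem_enum inE xy andbT.
  by move: yR; rewrite inE => /andP[].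
have RU x : x \in R :\: U -> x \notin B -> x \in R :\: B :\: U.
  by rewrite !inE => /andP[-> ->] ->.
exists (fun x => if x \in B then k x * P.+1 + d x else f x) => [x xR|x y xR yR xy].
  case: ifP => [xB|/negbT xB]; last by apply: fQ; apply: RU.
  have [dx _] := dP x xB; apply: (@leq_trans ((k x).+1 * P.+1)).
    by rewrite mulSn addnC ltn_add2r.
  by rewrite leq_mul2r kQ.
have md u : u \in B -> (k u * P.+1 + d u) %% P.+1 = d u.
  by move=> /dP[du _]; rewrite modnMDl modn_small.
have dv u : u \in B -> (k u * P.+1 + d u) %/ P.+1 = k u.
  by move=> /dP[du _]; rewrite divnMDl // divn_small // addn0.
case: ifP => [xB|/negbT xB]; case: ifP => [yB|/negbT yB] e.
- by apply: (kp x y) => //; rewrite -(dv x) // e dv.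
- by have [_ /(_ y (RU y yR yB) xy)] := dP x xB; rewrite -e md.
- have [_ /(_ x (RU x xR xB))] := dP y yB; rewrite adj_sym => /(_ xy).
  by rewrite e md.
- by apply: (fp x y) => //; apply: RU.
Qed.

(** Bounds the neighbours that a removed vertex keeps: one Ramsey bound for each pair of a vertex
    and a subset of a clique on [(2 * s).-1] vertices, and one for an exceptional class. *)
Definition pineapple_deg s k w :=
  ((2 * s).-1 * 2 ^ (2 * s).-1 + 1) * (k * w.+1 ^ k * k).

(** Colours for a removed set: those of the clique, plus those of the neighbourhoods of its
    [(2 * s).-1] vertices. *)
Definition pineapple_col s k c w :=
  (2 * s).-1 + (2 * s).-1 * (k.+1 * c.+1 * w.+1 ^ (s * k.+1)).

Section Peeling.
Variables (s k c : nat).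
Hypotheses (s_gt0 : 0 < s) (free : pineapple_free_in s k).
Hypothesis hc : forall A, om A < (2 * s).-1 -> setcol A c.

(** A neighbourhood contains no [k.+1] disjoint anticomplete copies of [K_s]: one copy would serve
    as [T], and one vertex from each of the others as a leaf. *)
Lemma setcol_nbhd_pineapple v R : setcol [set x in R | adj v x]
  (k.+1 * c.+1 * (om R).+1 ^ (s * k.+1)).
Proof.
set N := [set x in R | adj v x].
apply: (@col_sub _ _ N _ _ (subxx _)) (@col_mK_free _ s c s_gt0 _ k.+1 N _).
- rewrite leq_mul2l leq_expl ?orbT // ltnS om_sub //.
  by apply/subsetP => x; rewrite inE => /andP[].
- by move=> A As; apply: hc; lia.
move=> [S [SN cS Ss /has_mK_stable[//|I [IA sI Ik]]]].
apply: (@free v S I) => //.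
- by move=> u /(subsetP SN); rewrite inE => /andP[].
- by move=> u /(subsetP IA); rewrite !inE => /andP[/andP[]].
- move=> u x uS /(subsetP IA)/setIP[_ /antiP[xS /(_ u uS)]]; split=> //.
  by apply: contraNneq xS => <-.
Qed.

Lemma card_pineapple_leaves v T R Y : clique T -> #|T| = s ->
  {in T, forall u, adj v u} -> Y \subset R -> {in Y, forall y, adj v y} ->
  {in T & Y, forall u y, u != y /\ ~~ adj u y} ->
  #|Y| <= k * (om R).+1 ^ k * k.
Proof.
move=> cT Ts vT YR vY TY.
apply: (@leq_trans (k * (om Y).+1 ^ k * k)); last first.
  by rewrite leq_mul2r leq_mul2l leq_expl ?orbT // ltnS om_sub.
apply: card_no_stable => I IY sI Ik; apply: (@free v T I) => //.
  by move=> u /(subsetP IY)/vY.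
by move=> u x uT /(subsetP IY); apply: TY.
Qed.

(** A set around a clique on [(2 * s).-1] vertices is removed as long as there is such a clique; [U]
    is what remains at the end. *)
Lemma pineapple_peel R : exists U, [/\ U \subset R, om U < (2 * s).-1
  & setcol (R :\: U)
      (pineapple_col s k c (om R) * (pineapple_deg s k (om R)).+1)].
Proof.
have [n] := ubnP #|R|; elim: n R => // n IHn R; rewrite ltnS => Rn.
have [small|big] := ltnP (om R) (2 * s).-1.
  by exists R; split=> //; rewrite setDv; apply: col_set0.
have [K0 [K0R cK0 K0w]] := om_witness R.
rewrite -K0w in big; have [K KK0 Ks] := exists_subset_card big.
have KR := subset_trans KK0 K0R; have cK := clique_sub KK0 cK0.
have /card_gt0P[u0 u0K] : 0 < #|K| by lia.
pose nn x := [set u in K | ~~ adj u x].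
(* Since [#|K| = (2 * s).-1], every vertex has at least [s] neighbours or at least [s]
   non-neighbours in [K]. Those outside [B] have [s] non-neighbours; those of [B] outside [K] have
   [s] neighbours. *)
pose B := K :|: [set x in R | #|nn x| < s].
have BR : B \subset R.
  by rewrite subUset KR; apply/subsetP => x; rewrite inE => /andP[].
have nbrs x : x \notin K -> #|nn x| < s ->
    exists T, [/\ T \subset K, clique T, #|T| = s & {in T, forall u, adj x u}].
  move=> xK xs; have: s <= #|K :\: nn x|.
    by have := cardsID (nn x) K; have := subset_leq_card (subsetIr K (nn x)); lia.
  move=> /exists_subset_card[T TK Ts].
  have TK' := subset_trans TK (subsetDl _ _).
  exists T; split=> //; first exact: clique_sub cK.
  by move=> u /(subsetP TK); rewrite !inE => /andP[] + uK; rewrite uK /= negbK adj_sym.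
have colB : setcol B (pineapple_col s k c (om R)).
  have BN : B \subset K :|: \bigcup_(v in K) [set x in R | adj v x].
    apply/subsetP => x; rewrite !inE; have [//|xK /= /andP[xR xs]] := boolP (x \in K).
    have [T [TK _ Ts xT]] := nbrs x xK xs.
    have /card_gt0P[u uT] : 0 < #|T| by rewrite Ts.
    by apply/bigcupP; exists u; rewrite ?(subsetP TK) // inE xR adj_sym xT.
  have := colU (col_card K) (@col_bigcup _ _ K _ _ (fun v _ => setcol_nbhd_pineapple v R)).
  by rewrite Ks; apply: col_sub BN _.
have degB : {in B, forall x, #|[set y in R :\: B | adj x y]| <= pineapple_deg s k (om R)}.
  move=> x xB; set Nx := [set y in _ | _].
  (* A neighbour [y] of [x] outside [B] that touches [K] is a leaf at some [u] in [K], over [s]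
     non-neighbours of [y] (class [Y]). If [y] misses all of [K] (class [Z]), then [x] is outside
     [K] and [y] is a leaf at [x], over [s] neighbours of [x] in [K]. *)
  pose Y (p : G * {set G}) := [set y in R :\: K | adj p.1 y && (p.2 \subset nn y) && (#|p.2| == s)].
  pose Z := [set y in R :\: K | [&& adj x y, x \notin K & nn y == K]].
  have NYZ : Nx \subset (\bigcup_(p in setX K (powerset K)) Y p) :|: Z.
    apply/subsetP => y; rewrite !inE negb_or => /andP[/andP[/andP[yK +] yR]].
    rewrite yR (negPf yK) /= -leqNgt => ys xy.
    have nnK : nn y \subset K by apply/subsetP => u; rewrite inE => /andP[].
    have [e|ne] := eqVneq (nn y) K.
      rewrite xy andbT /= orbC; suff -> : x \notin K by [].
      apply/negP => xK; have : x \in nn y by rewrite e.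
      by rewrite inE xy andbF.
    apply/orP; left.
    have [u uK uy] : exists2 u, u \in K & u \notin nn y.
      by apply/subsetPn; apply: contra ne => Kn; rewrite eqEsubset nnK.
    have [S Sn Ss] := exists_subset_card ys.
    apply/bigcupP; exists (u, S).
      by rewrite inE /= uK inE (subset_trans Sn nnK).
    rewrite !inE yR yK /= Sn Ss eqxx !andbT.
    by move: uy; rewrite inE uK /= negbK.
  apply: leq_trans (subset_leq_card NYZ) _.
  rewrite cardsU (leq_trans (leq_subr _ _)) // /pineapple_deg mulnDl mul1n leq_add //.
    have := @card_bigcup_le _ _ (setX K (powerset K)) Y (k * (om R).+1 ^ k * k).
    rewrite cardsX card_powerset Ks; apply=> -[u S]; rewrite !inE /= => /andP[uK SK].
    have [Ss|nS] := eqVneq #|S| s; last first.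
      rewrite (_ : Y _ = set0) ?cards0 //; apply/setP => y.
      by rewrite !inE /= (negPf nS) !andbF.
    have [S0|[y0]] := set_0Vmem (Y (u, S)); first by rewrite S0 cards0.
    rewrite inE /= => /andP[_ /andP[/andP[uy0 Sy0] _]].
    apply: (@card_pineapple_leaves u S).
    - exact: clique_sub cK.
    - by [].
    - move=> v vS; move/cliqueP: cK => /(_ u v uK (subsetP SK v vS)); apply.
      apply: contraTneq uy0 => ->.
      by have := subsetP Sy0 v vS; rewrite inE => /andP[].
    - by apply/subsetP => y; rewrite !inE => /andP[/andP[]].
    - by move=> y; rewrite inE => /andP[_ /andP[/andP[]]].
    - move=> v y vS; rewrite inE /= => /andP[yRK /andP[/andP[_ /subsetP/(_ v vS)]]].
      rewrite inE => /andP[vK vy]; split=> //.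
      by apply: contraTneq vK => ->; case/setDP: yRK.
  have [S0|[y0]] := set_0Vmem Z; first by rewrite S0 cards0.
  rewrite inE => /and4P[_ _ xK _].
  move: xB; rewrite !inE (negPf xK) /= => /andP[xR xs].
  have [T [TK cT Ts xT]] := nbrs x xK xs.
  apply: (@card_pineapple_leaves x T) => //.
  - by apply/subsetP => y; rewrite !inE => /andP[/andP[]].
  - by move=> y; rewrite inE => /and4P[].
  - move=> u y uT; rewrite inE => /and4P[/setDP[_ yK] _ _ /eqP e].
    have uK := subsetP TK u uT; split; first by apply: contraNneq yK => <-.
    by move: uK; rewrite -e inE => /andP[].
have lt : #|R :\: B| < n.
  apply: leq_trans Rn; apply: proper_card; apply/properP; split; first exact: subsetDl.
  by exists u0; rewrite ?(subsetP KR) // !inE u0K.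
have [U [UR Us cU]] := IHn _ lt.
exists U; split=> //; first by apply: subset_trans UR (subsetDl _ _).
apply: (setcol_peel BR colB UR degB).
have w : om (R :\: B) <= om R by rewrite om_sub // subsetDl.
apply: col_sub (subxx _) _ cU.
have le e : (om (R :\: B)).+1 ^ e <= (om R).+1 ^ e by rewrite leq_expl.
apply: leq_mul; first by rewrite leq_add2l leq_mul2l leq_mul2l le !orbT.
by rewrite ltnS leq_mul2l leq_mul2r leq_mul2l le !orbT.
Qed.

Lemma setcol_pineapple_free R :
  setcol R ((((2 * s).-1 + (2 * s).-1 * (k.+1 * c.+1)) *
     (((2 * s).-1 * 2 ^ (2 * s).-1 + 1) * k * k).+1 + c) *
     (om R).+1 ^ (s * k.+1 + k)).
Proof.
have [U [UR Us cU]] := pineapple_peel R.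
have := colU cU (hc Us); apply: col_sub.
  by apply/subsetP => x xR; rewrite !inE xR andbT orNb.
rewrite /pineapple_col /pineapple_deg expnD.
have: 0 < (om R).+1 ^ (s * k.+1) by rewrite expn_gt0.
have: 0 < (om R).+1 ^ k by rewrite expn_gt0.
move: (_ ^ (s * k.+1)) (_ ^ k) ((2 * s).-1 * 2 ^ _ + 1) => a b d b0 a0.
move: (2 * s).-1 (k.+1 * c.+1) => m e.
rewrite [leqRHS]mulnDl leq_add ?leq_pmulr ?muln_gt0 ?a0 //.
rewrite mulnACA leq_mul //; nia.
Qed.
End Peeling.
End Pineapple.

Lemma pineapple_free_in_of_induced (G : sgraph) t k : 0 < t ->
  induced_free (pineapple t k) G -> pineapple_free_in G t.-1 k.
Proof.
case: t => // t _ free v T I cT Ts vT sI Ik vI TI /=.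
have vTn : v \notin T by apply/negP => /vT; rewrite adj_irr.
pose f (u : pineapple t.+1 k) : G := match u with
  | inl i => if unlift ord0 i is Some j then enum_val (cast_ord (esym Ts) j) else v
  | inr i => enum_val (cast_ord (esym Ik) i) end.
have eT j : enum_val (cast_ord (esym Ts) j) \in T by apply: enum_valP.
have eI j : enum_val (cast_ord (esym Ik) j) \in I by apply: enum_valP.
have iT i j : enum_val (cast_ord (esym Ts) i) = enum_val (cast_ord (esym Ts) j) -> i = j.
  by move/enum_val_inj/cast_ord_inj.
have iI i j : enum_val (cast_ord (esym Ik) i) = enum_val (cast_ord (esym Ik) j) -> i = j.
  by move/enum_val_inj/cast_ord_inj.
have fa u u' : adj (f u) (f u') = adj u u'.
  case: u => i; case: u' => j /=.
  - case: unliftP => [i' ->|->]; case: unliftP => [j' ->|->] /=.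
    + rewrite (inj_eq lift_inj); apply/idP/idP => [|ne].
        by apply: contraTneq => ->; rewrite adj_irr.
      by move/cliqueP: cT; apply=> //; apply: contraNneq ne => /iT ->.
    + by rewrite adj_sym vT // eq_sym neq_lift.
    + by rewrite vT // neq_lift.
    + by rewrite adj_irr.
  - case: unliftP => [i' ->|->] /=; last by rewrite vI.
    by apply: negbTE; have [] := TI _ _ (eT i') (eI j).
  - case: unliftP => [i' ->|->] /=; last by rewrite adj_sym vI.
    by rewrite adj_sym; apply: negbTE; have [] := TI _ _ (eT i') (eI i).
  - exact/negbTE/sI.
apply: (induced_freeE free (f := f)) => // u u' e.
case: u u' e => i [] j e.
- by have := fa (inl i) (inl j); rewrite e adj_irr /= => /esym/negbFE/eqP ->.
- move: e; rewrite /f; case: unliftP => [i' _|_] e.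
    by have [/eqP] := TI _ _ (eT i') (eI j).
  by have := vI _ (eI j); rewrite -e adj_irr.
- move: e; rewrite /f; case: unliftP => [i' _|_] e.
    by have [/eqP[]] := TI _ _ (eT i') (eI i).
  by have := vI _ (eI i); rewrite e adj_irr.
- by congr inr; apply: iI.
Qed.

Lemma strongly_pollyanna_pineapple t k : 0 < t ->
  strongly_pollyanna (2 * t%:Z - 4)%R (induced_free (pineapple t k)).
Proof.
move=> t0 F /good_col[c hc].
(* The maximum matters for [t = 1] only, where freeness with [T] empty implies freeness with [T] a
   single vertex. *)
pose s := maxn 1 t.-1.
have s0 : 0 < s by rewrite leq_maxl.
apply: poly_chi_bounded_of_col => G [/(pineapple_free_in_of_induced t0) free FG] A.
apply: (@setcol_pineapple_free G s k c) => // [v T I|B Bs]; last first.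
  (* For [t <= 2] we have [(2 * s).-1 = 1], so [B] is empty; this covers [t = 1], where [2 * t - 4]
     is negative. *)
  have [t3|t2] := leqP 3 t.
    by apply: hc => //; move: Bs; rewrite /s; lia.
  apply: col_sub (subxx _) (leq0n _) (col_om0 _).
  by move: Bs; rewrite /s; lia.
move: s0; rewrite /s; case: t t0 free {hc s} => [|[|t]] //= _ free _.
  rewrite maxn0 => cT Ts vT sI Ik vI TI.
  by apply: (free v set0 I) => //; [apply: clique0|apply: cards0|..] => u; rewrite inE.
by rewrite (maxn_idPr _) //; apply: free.
Qed.

(** * Lollipops *)

Lemma leq_expD a b e : 0 < e -> a ^ e + b ^ e <= (a + b) ^ e.
Proof.
case: e => // e _; rewrite !expnS mulnDl leq_add // leq_mul2l leq_expl ?orbT //.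
  exact: leq_addr.
exact: leq_addl.
Qed.

(** The induction for lollipops needs a bound superadditive in [om A], hence a pure power; the [.+1]
    is traded for a factor [2 ^ e]. *)
Lemma leq_expS_double w e : 0 < w -> w.+1 ^ e <= 2 ^ e * w ^ e.
Proof. by move=> w0; rewrite -expnMn leq_expl //; lia. Qed.

Lemma setDUK (T : finType) (A B : {set T}) : A \subset B -> A :|: B :\: A = B.
Proof. by move=> AB; rewrite -{1}(setIidPr AB) setID. Qed.

Section Lollipop.
Variable G : sgraph.
Implicit Types (x y z u v a b c : G) (A B C E K S T X : {set G}).

Lemma colU_anti A B n : {in A & B, forall x y, ~~ adj x y} ->
  setcol A n -> setcol B n -> setcol (A :|: B) n.
Proof.
move=> AB [f fl fp] [g gl gp].
exists (fun x => if x \in A then f x else g x) => [x|x y].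
  by rewrite inE; case: ifP => [xA _|_ /=]; [apply: fl|apply: gl].
rewrite !inE; case: ifP => xA; case: ifP => yA //= xB yB.
- exact: fp.
- by rewrite (negPf (AB _ _ xA yB)).
- by rewrite adj_sym (negPf (AB _ _ yA xB)).
- exact: gp.
Qed.

(** [T] with [a] forms the clique and [b], [c] the path, so [s] stands for [t - 1]. *)
Definition lollipop_free_in s := forall T a b c, clique T -> #|T| = s ->
  {in T, forall u, adj a u} -> adj a b -> adj b c -> a != c -> ~~ adj a c ->
  ~ {in T, forall u, ~~ adj u b /\ ~~ adj u c}.

Definition touches K x := [exists u in K, adj u x].

Lemma touchesPn K x : reflect {in K, forall u, ~~ adj u x} (~~ touches K x).
Proof. by rewrite negb_exists_in; apply: forall_inP. Qed.

Section Structure.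
Variable s : nat.
Hypotheses (s_gt0 : 0 < s) (free : lollipop_free_in s).

Lemma no_lollipop T a b c : clique T -> #|T| = s ->
  {in T, forall u, adj a u} -> adj a b -> adj b c -> ~~ adj a c ->
  {in T, forall u, ~~ adj u b /\ ~~ adj u c} -> False.
Proof.
move=> cT Ts aT ab bc ac Tbc; apply: (free cT Ts aT ab bc _ ac Tbc).
have /card_gt0P[u uT] : 0 < #|T| by rewrite Ts.
by have [_ uc] := Tbc u uT; apply: contraNneq uc => <-; rewrite adj_sym aT.
Qed.

(** If [b] had [s] non-neighbours in [K], these with a neighbour [a] of [b] in [K] and the path [b],
    [c] would form a lollipop. So [b] has at least [s] neighbours there. *)
Lemma lollipop_nbrs K b c : clique K -> (2 * s).-1 <= #|K| -> touches K b ->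
  ~~ touches K c -> adj b c ->
  exists T, [/\ T \subset K, clique T, #|T| = s & {in T, forall u, adj b u}].
Proof.
move=> cK qK /exists_inP[a aK ab] /touchesPn Kc bc.
pose nn := [set u in K | ~~ adj u b].
have nnK : nn \subset K by apply/subsetP => u; rewrite inE => /andP[].
have ns : #|nn| < s.
  rewrite ltnNge; apply/negP => /exists_subset_card[T Tn Ts].
  have TK := subset_trans Tn nnK.
  have Tb u : u \in T -> ~~ adj u b.
    by move/(subsetP Tn); rewrite inE => /andP[].
  apply: (@no_lollipop T a b c) => //.
  - exact: clique_sub cK.
  - move=> u uT; move/cliqueP: cK => /(_ a u aK (subsetP TK u uT)); apply.
    by apply: contraTneq ab => ->; apply: Tb.
  - exact: Kc.
  - by move=> u uT; split; [apply: Tb|apply/Kc/(subsetP TK)].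
have: s <= #|K :\: nn| by have := cardsID nn K; rewrite (setIidPr nnK); lia.
move=> /exists_subset_card[T TK Ts].
have TK' := subset_trans TK (subsetDl _ _).
exists T; split=> //; first exact: clique_sub cK.
by move=> u /(subsetP TK); rewrite !inE => /andP[] + uK; rewrite uK /= negbK adj_sym.
Qed.

(** If [x] has a neighbour [k] and a non-neighbour [u] in [K], then [s] neighbours of [x] in [C]
    with [x], [k], [u] form a lollipop. *)
Lemma touches_both_complete K C x : clique K -> clique C ->
  (2 * s).-1 <= #|C| -> {in K & C, forall u v, ~~ adj u v} ->
  touches K x -> touches C x -> {in K, forall u, adj u x}.
Proof.
move=> cK cC qC KC Kx Cx u uK; apply/negPn/negP => ux.
have /exists_inP[k kK kx] := Kx.
have Ck w : w \in K -> ~~ touches C w.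
  by move=> wK; apply/touchesPn => v vC; rewrite adj_sym KC.
have [|T [TC cT Ts xT]] := lollipop_nbrs cC qC Cx (Ck k kK).
  by rewrite adj_sym.
apply: (@no_lollipop T x k u) => //.
- by rewrite adj_sym.
- move/cliqueP: cK; apply=> //; by apply: contraTneq kx => ->.
- by rewrite adj_sym.
- by move=> v /(subsetP TC) vC; split; rewrite adj_sym KC.
Qed.

Definition far_pair A (p : {set G} * {set G}) :=
  [&& p.1 \subset A, p.2 \subset A, clique p.1, clique p.2,
      (2 * s).-1 <= #|p.1|, (2 * s).-1 <= #|p.2| & p.2 \subset anti p.1].

Lemma anti_sym K C : C \subset anti K -> K \subset anti C.
Proof.
move=> /subsetP CK; apply/subsetP => u uK; apply/antiP; split.
  by apply/negP => /CK/antiP[/negP].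
by move=> v /CK/antiP[_ /(_ u uK)]; rewrite adj_sym.
Qed.

(** [E] may leave [anti K] by meeting [K]; then a second vertex of [E] touches [K]. *)
Lemma touches_of_not_anti K E : clique E -> 1 < #|E| -> ~~ (E \subset anti K) ->
  exists2 e, e \in E & touches K e.
Proof.
move=> cE E1 /subsetPn[e eE]; rewrite inE negb_and negbK => /orP[eK|]; last first.
  rewrite negb_forall_in => /exists_inP[u uK]; rewrite negbK => ue.
  by exists e => //; apply/exists_inP; exists u.
have : 0 < #|E :\ e| by move: E1; rewrite (cardsD1 e) eE; lia.
move=> /card_gt0P[f]; rewrite !inE => /andP[fe fE]; exists f => //.
apply/exists_inP; exists e => //; move/cliqueP: cE; apply=> //.
by rewrite eq_sym.
Qed.

Lemma setcol_lollipop_free (C0 e : nat) : 0 < e ->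
  (forall A, ~ has_mK (2 * s).-1 2 A -> setcol A (C0 * om A ^ e)) ->
  forall A, setcol A (C0 * om A ^ e).
Proof.
move=> e0 base A; have [n] := ubnP #|A|; elim: n A => // n IHn A; rewrite ltnS => An.
have [/existsP[p0 hp0]|] := boolP [exists p, far_pair A p]; last first.
  rewrite negb_exists => /forallP no; apply: base.
  move=> [K [KA cK Kq [C [CA cC Cq _]]]]; apply: (negP (no (K, C))).
  have [CA' CK] : C \subset A /\ C \subset anti K by move: CA; rewrite subsetI => /andP[].
  by rewrite /far_pair /= KA CA' cK cC Kq Cq !leqnn.
have [[K C] /and5P[/= KA CA cK cC /and3P[qK qC CK]] maxK] :=
  @arg_maxnP _ p0 (far_pair A) (fun p => #|p.1|) hp0.
have KC u v : u \in K -> v \in C -> ~~ adj u v.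
  by move=> uK /(subsetP CK)/antiP[_]; apply.
have q0 : 0 < (2 * s).-1 by lia.
have /card_gt0P[k kK] : 0 < #|K| by lia.
have /card_gt0P[c cC'] : 0 < #|C| by lia.
pose X := [set x in A | touches K x && touches C x].
have XA : X \subset A by apply/subsetP => x; rewrite inE => /andP[].
have XK x : x \in X -> {in K, forall u, adj u x}.
  by rewrite inE => /and3P[_]; apply: touches_both_complete.
have XKdisj : [disjoint X & K].
  apply/pred0P => x; apply/negP => /= /andP[xX xK].
  by have := XK x xX x xK; rewrite adj_irr.
have [X0|[x0 x0X]] := set_0Vmem X.
  have noX x : x \in A -> touches K x -> ~~ touches C x.
    by move=> xA Kx; apply/negP => Cx; have : x \in X by [rewrite inE xA Kx]; rewrite X0 inE.
  (* Without a vertex touching both cliques, the vertices at distance at most 2 from [K] form a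
     union of components of [A] avoiding [C]: a path [w], [x], [y] leading further away would
     complete a lollipop with neighbours of [w] in [K]. *)
  pose A' := [set x in A | [|| x \in K, touches K x
                 | [exists w in A, touches K w && adj w x]]].
  have A'A : A' \subset A by apply/subsetP => x; rewrite inE => /andP[].
  have closed x y : x \in A' -> y \in A -> adj x y -> y \in A'.
    rewrite inE => /andP[xA h] yA xy; rewrite inE yA /=.
    case: (boolP (touches K y)) => [_|Ky] /=; first by rewrite orbT.
    have [xK|xK] := boolP (x \in K).
      by move/touchesPn: Ky => /(_ x xK); rewrite xy.
    have [Kx|Kx] := boolP (touches K x).
      by apply/orP; right; apply/exists_inP; exists x; rewrite ?Kx.
    move: h; rewrite (negPf xK) (negPf Kx) /= => /exists_inP[w wA /andP[Kw wx]].
    apply/orP; right; apply/exists_inP; exists w => //; rewrite Kw /=.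
    apply/negPn/negP => wy.
    have [T [TK cT Ts wT]] := lollipop_nbrs cK qK Kw Kx wx.
    apply: (@no_lollipop T w x y) => // u /(subsetP TK) uK.
    by split; [move/touchesPn: Kx|move/touchesPn: Ky]; apply.
  have kA' : k \in A' by rewrite inE (subsetP KA) // kK.
  have cA' : c \notin A'.
    have /antiP[cK' cKa] := subsetP CK c cC'.
    rewrite inE (subsetP CA) // (negPf cK') /= negb_or; apply/andP; split.
      exact/touchesPn.
    apply/exists_inP => -[w wA /andP[Kw wc]].
    move: (noX w wA Kw) => /touchesPn/(_ c cC'); rewrite adj_sym.
    by rewrite wc.
  have := @colU_anti A' (A :\: A') (C0 * om A ^ e); rewrite (setDUK A'A).
  apply.
  - move=> x y xA' /setDP[yA]; apply: contra; exact: closed.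
  - apply: col_sub (subxx _) _ (IHn A' _).
      by rewrite leq_mul2l leq_expl ?orbT // om_sub.
    apply: leq_trans An; apply: proper_card; apply/properP; split=> //.
    by exists c => //; apply: (subsetP CA).
  - apply: col_sub (subxx _) _ (IHn (A :\: A') _).
      by rewrite leq_mul2l leq_expl ?orbT // om_sub // subsetDl.
    apply: leq_trans An; apply: proper_card; apply/properP; split; first exact: subsetDl.
    by exists k; [apply: (subsetP KA)|rewrite inE kA'].
have omX : om X + #|K| <= om A.
  have [L [LX cL <-]] := om_witness X.
  have LK : [disjoint L & K] by apply: disjointWl LX XKdisj.
  move: LK; rewrite -leq_card_setU => /eqP <-; apply: clique_card_le_om.
    by rewrite subUset KA (subset_trans LX).
  apply: cliqueU => // x u /(subsetP LX) xX uK; rewrite adj_sym; exact: XK.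
(* By the choice of [K], a larger clique [E] is anticomplete to neither [K] nor [C]. As [E] avoids
   [X], different vertices [x], [y] of [E] touch [K] and [C]; neighbours of [x] in [K], then [x],
   [y] and a vertex of [C], form a lollipop. *)
have omD : om (A :\: X) <= #|K|.
  apply/om_leP => E /subsetP EA cE; rewrite leqNgt; apply/negP => KE.
  have EA' : E \subset A by apply/subsetP => x /EA/setDP[].
  have noP D : D \in [:: K; C] -> ~~ (E \subset anti D).
    move=> hD; apply/negP => ED.
    suff /maxK /= : far_pair A (E, D) by rewrite leqNgt KE.
    rewrite /far_pair /= EA' cE (anti_sym ED) (leq_trans qK (ltnW KE)) !andbT /=.
    by move: hD; rewrite !inE => /orP[]/eqP->; rewrite ?KA ?CA ?cK ?cC ?qK ?qC.
  have E1 : 1 < #|E| by lia.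
  have [x xE Kx] : exists2 e, e \in E & touches K e.
    by apply: touches_of_not_anti => //; apply: noP; rewrite mem_head.
  have [y yE Cy] : exists2 e, e \in E & touches C e.
    by apply: touches_of_not_anti => //; apply: noP; rewrite !inE eqxx orbT.
  have Cx : ~~ touches C x.
    by have /setDP[xA] := EA x xE; rewrite inE xA Kx.
  have Ky : ~~ touches K y.
    by have /setDP[yA] := EA y yE; rewrite inE yA Cy andbT.
  have xy : adj x y.
    by move/cliqueP: cE; apply=> //; apply: contraTneq Kx => ->.
  have [T [TK cT Ts xT]] := lollipop_nbrs cK qK Kx Ky xy.
  have /exists_inP[v vC vy] := Cy.
  apply: (@no_lollipop T x y v) => //.
  - by rewrite adj_sym.
  - by rewrite adj_sym; move/touchesPn: Cx; apply.
  - move=> u /(subsetP TK) uK; split; last exact: KC.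
    by move/touchesPn: Ky; apply.
have := @colU _ X (A :\: X) (C0 * om X ^ e) (C0 * om (A :\: X) ^ e).
rewrite (setDUK XA) => col2.
apply: col_sub (subxx _) _ (col2 _ _).
- rewrite -mulnDr leq_mul2l (leq_trans (leq_expD _ _ e0)) ?orbT //.
  by rewrite leq_expl // (leq_trans _ omX) // leq_add2l.
- apply: IHn; apply: leq_trans An; apply: proper_card; apply/properP; split=> //.
  by exists k; [apply: (subsetP KA)|move/pred0P: XKdisj => /(_ k) /=; rewrite kK andbT => ->].
- apply: IHn; apply: leq_trans An; apply: proper_card; apply/properP.
  by split; [apply: subsetDl|exists x0; [apply: (subsetP XA)|rewrite inE x0X]].
Qed.
End Structure.
End Lollipop.

Lemma lollipop_free_in_of_induced (G : sgraph) t : 0 < t ->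
  induced_free (lollipop t) G -> lollipop_free_in G t.-1.
Proof.
case: t => // t _ free T a b c cT Ts aT ab bc nac ac Tbc /=.
pose f (u : lollipop t.+1) : G := match u with
  | inl i => if unlift ord0 i is Some j then enum_val (cast_ord (esym Ts) j) else a
  | inr i => if i == ord0 then b else c end.
have eT j : enum_val (cast_ord (esym Ts) j) \in T by apply: enum_valP.
have iT i j : enum_val (cast_ord (esym Ts) i) = enum_val (cast_ord (esym Ts) j) -> i = j.
  by move/enum_val_inj/cast_ord_inj.
have fa u u' : adj (f u) (f u') = adj u u'.
  case: u => i; case: u' => j /=.
  - case: unliftP => [i' ->|->]; case: unliftP => [j' ->|->] /=.
    + rewrite (inj_eq lift_inj); apply/idP/idP => [|ne].
        by apply: contraTneq => ->; rewrite adj_irr.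
      by move/cliqueP: cT; apply=> //; apply: contraNneq ne => /iT ->.
    + by rewrite adj_sym aT // eq_sym neq_lift.
    + by rewrite aT // neq_lift.
    + by rewrite adj_irr.
  - case: unliftP => [i' ->|->] /=.
      by have [/negPf ? /negPf ?] := Tbc _ (eT i'); case: ifP.
    by case: eqP => [->|/eqP]; rewrite ?ab // -val_eqE /= => /negPf ->; rewrite (negPf ac).
  - case: unliftP => [i' ->|->] /=.
      by have [/negPf hb /negPf hc] := Tbc _ (eT i'); case: ifP; rewrite adj_sym.
    case: eqP => [->|/eqP]; first by rewrite adj_sym ab.
    by rewrite -val_eqE /= => /negPf ->; rewrite adj_sym (negPf ac).
  - case: i => -[|[|//]] pi; case: j => -[|[|//]] pj; rewrite -!val_eqE /= ?adj_irr //.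
    by rewrite adj_sym.
have nab : a != b by apply: adj_neq.
apply: (induced_freeE free (f := f)) => // u u' e.
have bc' := adj_neq bc.
case: u u' e => i [] j e.
- by have := fa (inl i) (inl j); rewrite e adj_irr /= => /esym/negbFE/eqP ->.
- exfalso; move: e; rewrite /f; case: unliftP => [i' _|_]; case: ifP => _ e.
  + by have [_] := Tbc _ (eT i'); rewrite e bc.
  + by have := aT _ (eT i'); rewrite e (negPf ac).
  + by rewrite e eqxx in nab.
  + by rewrite e eqxx in nac.
- exfalso; move: e; rewrite /f; case: unliftP => [i' _|_]; case: ifP => _ e.
  + by have [_] := Tbc _ (eT i'); rewrite -e bc.
  + by have := aT _ (eT i'); rewrite -e (negPf ac).
  + by rewrite e eqxx in nab.
  + by rewrite e eqxx in nac.
- by have := fa (inr i) (inr j); rewrite e adj_irr /= => /esym/negbFE/eqP ->.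
Qed.

Lemma strongly_pollyanna_lollipop t : 0 < t ->
  strongly_pollyanna (3 * t%:Z - 6)%R (induced_free (lollipop t)).
Proof.
move=> t0 F /good_col[c hc].
pose s := maxn 1 t.-1; pose e := (2 * s).-1 * 2.
have s0 : 0 < s by rewrite leq_maxl.
apply: (@poly_chi_bounded_of_col _ (2 * c.+1 * 2 ^ e) e) => G [/(lollipop_free_in_of_induced t0) free FG] A.
have hs (B : {set G}) : om B < (2 * s).-1 -> setcol B c.
  move=> Bs; have [t3|t2] := leqP 3 t.
    by apply: hc => //; move: Bs; rewrite /s; lia.
  apply: col_sub (subxx _) (leq0n _) (col_om0 _).
  by move: Bs; rewrite /s; lia.
have free' : lollipop_free_in G s.
  rewrite /s; case: t t0 free {hc hs s e s0} => [|[|t]] //= _ free.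
    rewrite maxn0 => T a b d cT Ts aT ab bd nad ad Tbd.
    by apply: (free set0 a b d) => //; [apply: clique0|apply: cards0|..] => u; rewrite inE.
  by rewrite (maxn_idPr _) //; apply: free.
have q0 : 0 < (2 * s).-1 by lia.
have e0 : 0 < e by rewrite /e; lia.
have base (B : {set G}) : ~ has_mK (2 * s).-1 2 B -> setcol B (2 * c.+1 * 2 ^ e * om B ^ e).
  move=> nB; have [B0|] := posnP (om B); first by rewrite (om_eq0 B0); apply: col_set0.
  move=> B0; apply: col_sub (subxx _) _ (col_mK_free q0 hs nB).
  by rewrite -[leqRHS]mulnA leq_mul2l leq_expS_double ?orbT.
apply: col_sub (subxx _) _ (setcol_lollipop_free s0 free' e0 base A).
by rewrite leq_mul2l leq_expl ?orbT.
Qed.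

(** * Bowties *)

Lemma card_ge2P (T : finType) (A : {set T}) :
  1 < #|A| -> exists a b, [/\ a \in A, b \in A & a != b].
Proof.
move=> /exists_subset_card[B BA /eqP/cards2P[a [b [ab eB]]]].
by exists a, b; split=> //; apply: (subsetP BA); rewrite eB !inE eqxx ?orbT.
Qed.

Section Triangles.
Variable G : sgraph.
Implicit Types (x y z : G) (A B R U : {set G}) (g : G -> nat).

Definition triangle_free_classes A g :=
  {in A & &, forall x y z, adj x y -> adj x z -> adj y z -> g x = g y -> g x <> g z}.

Lemma setcol_stable A : om A <= 1 -> setcol A 1.
Proof.
move=> A1; exists (fun=> 0) => // x y xA yA xy _.
have: #|[set x; y]| <= 1.
  apply: leq_trans A1; apply: clique_card_le_om.
    by apply/subsetP => u /set2P[]->.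
  by rewrite setUC; apply: cliqueU (clique1 _) (clique1 _) _ => _ _ /set1P-> /set1P->; rewrite adj_sym.
by rewrite cards2 (adj_neq xy).
Qed.

Lemma om_triangle_free A :
  {in A & &, forall x y z, adj x y -> adj x z -> ~~ adj y z} -> om A <= 2.
Proof.
move=> h; apply/om_leP => K KA /cliqueP cK; rewrite leqNgt; apply/negP => K3.
have /card_gt0P[x xK] : 0 < #|K| by apply: leq_trans K3.
have : 1 < #|K :\ x| by move: K3; rewrite (cardsD1 x) xK.
move=> /card_ge2P[y [z []]]; rewrite !inE => /andP[yx yK] /andP[zx zK] yz.
have := h x y z (subsetP KA _ xK) (subsetP KA _ yK) (subsetP KA _ zK).
by rewrite !cK // 1?eq_sym // => /(_ isT isT).
Qed.

Lemma setcol_triangle_free_classes A g N c : {in A, forall x, g x < N} ->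
  triangle_free_classes A g -> (forall B, om B <= 2 -> setcol B c) ->
  setcol A (N * c).
Proof.
move=> gN gt hc; apply: (col_classes gN) => i; apply: hc.
apply: om_triangle_free => x y z; rewrite !inE.
move=> /andP[xA /eqP gx] /andP[yA /eqP gy] /andP[zA /eqP gz] xy xz.
by apply/negP => yz; apply: (gt x y z); rewrite ?gx.
Qed.
End Triangles.

Section Bowtie.
Variable G : sgraph.
Implicit Types (x y z u v a b : G) (A B K L R U : {set G}).

Definition bowtie_free_in := forall v a b x y,
  adj v a -> adj v b -> adj v x -> adj v y -> adj a b -> adj x y ->
  ~ [/\ ~~ adj a x, ~~ adj a y, ~~ adj b x & ~~ adj b y].

Hypothesis free : bowtie_free_in.

(** With [v], a [2K_2] in the neighbourhood would be a bowtie; [col_mK_free] applies with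
    [m = t = 2] and [c = 1]. *)
Lemma setcol_nbhd_bowtie v R :
  setcol [set x in R | adj v x] (4 * (om R).+1 ^ 4).
Proof.
set N := [set x in R | adj v x].
have hc A : om A < 2 -> setcol A 1 by rewrite ltnS; apply: setcol_stable.
have NP x : x \in N -> adj v x by rewrite inE => /andP[].
apply: col_sub (subxx _) _ (col_mK_free _ hc (_ : ~ has_mK 2 2 N)) => //.
  rewrite leq_mul2l leq_expl // ltnS om_sub //.
  by apply/subsetP => x; rewrite inE => /andP[].
move=> [S [/subsetP SN cS S2 [S' [/subsetP SN' cS' S2' _]]]].
have [a [b [aS bS ab]]] : exists a b, [/\ a \in S, b \in S & a != b].
  by apply: card_ge2P; rewrite S2.
have [x [y [xS yS xy]]] : exists a b, [/\ a \in S', b \in S' & a != b].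
  by apply: card_ge2P; rewrite S2'.
have SS u z : u \in S -> z \in S' -> ~~ adj u z.
  by move=> uS /SN'/setIP[_ /antiP[_]]; apply.
have vS' z : z \in S' -> adj v z by move=> /SN'/setIP[/NP].
apply: (free (v := v) (a := a) (b := b) (x := x) (y := y)).
- exact/NP/SN.
- exact/NP/SN.
- exact: vS'.
- exact: vS'.
- by move/cliqueP: cS; apply.
- by move/cliqueP: cS'; apply.
- by split; apply: SS.
Qed.

Section Peeling.
Variable K : {set G}.

Definition near L := [&& clique L, #|L| == 4 & 3 <= #|L :&: K|].

(** The set removed around a [K_4]. The cliques [L] that differ from [K] in one vertex are included
    because a vertex with three neighbours in [K] lies in such an [L]. *)
Definition bowtie_shell R := K :|:
  [set y in R | [exists L, near L && (2 <= #|[set u in L | adj u y]|)]].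

Lemma shellPn R z L u u' : z \in R -> z \notin bowtie_shell R -> near L ->
  u \in L -> u' \in L -> u != u' -> adj u z -> ~~ adj u' z.
Proof.
move=> zR; rewrite !inE zR /= negb_or => /andP[_].
rewrite negb_exists => /forallP/(_ L); rewrite negb_and -leqNgt => + nL.
rewrite nL /= => le uL u'L ne uz; apply/negP => u'z; move: le; rewrite leqNgt => /negP[].
have <- : #|[set u; u']| = 2 by rewrite cards2 ne.
by apply/subset_leq_card/subsetP => w /set2P[]->; rewrite inE ?uL ?u'L.
Qed.

(** Outside the shell, [z] and [w] see only [x] in [L], so an edge [zw] and two other vertices of
    [L] would form a bowtie centred at [x]. *)
Lemma near_adj_free R x z w L : near L -> x \in L ->
  z \in R :\: bowtie_shell R -> w \in R :\: bowtie_shell R ->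
  adj x z -> adj x w -> ~~ adj z w.
Proof.
move=> nL xL /setDP[zR zB] /setDP[wR wB] xz xw; apply/negP => zw.
have /and3P[/cliqueP cL /eqP L4 _] := nL.
have : 1 < #|L :\ x| by move: L4; rewrite (cardsD1 x) xL; lia.
move=> /card_ge2P[a [b []]]; rewrite !inE => /andP[ax aL] /andP[bx bL] ab.
have out u v : u \in L -> u != x -> v \in R -> v \notin bowtie_shell R -> adj x v -> ~~ adj u v.
  by move=> uL ux vR vB xv; apply: (shellPn vR vB nL xL uL) => //; rewrite eq_sym.
apply: (free (v := x) (a := a) (b := b) (x := z) (y := w)) => //.
- by apply: cL; rewrite // eq_sym.
- by apply: cL; rewrite // eq_sym.
- exact: cL.
- by split; apply: out.
Qed.

(** Let [a], [b] be the neighbours of [x] in [L] and [c], [d] its non-neighbours. If [a] or [b] were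
    adjacent to [z] or [w], it would be the centre of a bowtie containing [c], [d] and [x]. Hence an
    edge [zw] gives a bowtie centred at [x] with [a], [b]. *)
Lemma near_trace2_free R x z w L : near L -> #|[set u in L | adj u x]| = 2 ->
  z \in R :\: bowtie_shell R -> w \in R :\: bowtie_shell R ->
  adj x z -> adj x w -> ~~ adj z w.
Proof.
move=> nL L2 zRB wRB xz xw; apply/negP => zw.
have /and3P[/cliqueP qL /eqP L4 _] := nL.
have : 1 < #|L :\: [set u in L | adj u x]|.
  have := cardsID [set u in L | adj u x] L; rewrite L4.
  by have := subset_leq_card (subsetIr L [set u in L | adj u x]); rewrite L2; lia.
move=> /card_ge2P[c [d []]]; rewrite !inE => /andP[+ cL] /andP[+ dL] cd.
rewrite cL dL /= => cx dx.
have out u v : u \in L -> adj u x -> v \in R :\: bowtie_shell R -> adj x v -> ~~ adj u v.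
  move=> uL ux /setDP[vR vB] xv; apply/negP => uv.
  have uc : u != c by apply: contraTneq ux => ->.
  have ud : u != d by apply: contraTneq ux => ->.
  apply: (free (v := u) (a := c) (b := d) (x := x) (y := v)) => //.
  - exact: qL.
  - exact: qL.
  - exact: qL.
  - by split=> //; apply: (shellPn vR vB nL uL).
have [a [b []]] : exists a b, [/\ a \in [set u in L | adj u x], b \in [set u in L | adj u x] & a != b].
  by apply: card_ge2P; rewrite L2.
rewrite !inE => /andP[aL ax] /andP[bL bx] ab.
apply: (free (v := x) (a := a) (b := b) (x := z) (y := w)) => //.
- by rewrite adj_sym.
- by rewrite adj_sym.
- exact: qL.
- by split; apply: out.
Qed.

Hypotheses (cK : clique K) (K4 : #|K| = 4).

Lemma near_self : near K.
Proof. by rewrite /near cK K4 setIid K4. Qed.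

Lemma near_trace L x : near L ->
  #|[set u in L | adj u x]| <= #|[set u in K | adj u x]|.+1.
Proof.
move=> /and3P[_ /eqP L4 L3].
have LK : #|L :\: K| <= 1 by have := cardsID K L; rewrite L4; lia.
rewrite -(cardsID K) addnC -addn1 addnC leq_add //.
  by apply/subset_leq_card/subsetP => u; rewrite !inE => /andP[/andP[_ ->] ->].
by apply: leq_trans LK; apply/subset_leq_card/subsetP => u; rewrite !inE => /and3P[-> ->].
Qed.

(** Either [x] lies in a near clique ([K], or [x] with three neighbours in [K]), or it has exactly
    two neighbours in one: in [K], or else in [L] by [near_trace]. *)
Lemma shell_nbrs_stable R x z w : x \in bowtie_shell R ->
  z \in R :\: bowtie_shell R -> w \in R :\: bowtie_shell R ->
  adj x z -> adj x w -> ~~ adj z w.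
Proof.
case/setUP=> [xK|]; first exact: near_adj_free near_self xK.
rewrite inE => /andP[xR /existsP[L /andP[nL L2]]].
have [h|h] := ltnP 2 #|[set u in K | adj u x]|.
  have [T TK T3] := exists_subset_card h.
  have TP u : u \in T -> (u \in K) && adj u x by move/(subsetP TK); rewrite inE.
  have TK' : T \subset K by apply/subsetP => u /TP/andP[].
  have xT : x \notin T by apply/negP => /TP; rewrite adj_irr andbF.
  apply: (@near_adj_free R x z w (x |: T)); last by rewrite setU11.
  rewrite /near cardsU1 xT T3 eqxx; apply/andP; split.
    apply: cliqueU (clique1 x) _ _; first exact: clique_sub cK.
    by move=> _ u /set1P-> /TP/andP[_]; rewrite adj_sym.
  by rewrite /= -T3 subset_leq_card // subsetI subsetUr.
have [h2|h2] := eqVneq #|[set u in K | adj u x]| 2.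
  exact: near_trace2_free near_self h2.
apply: (@near_trace2_free R x z w L) => //.
have := near_trace x nL.
by move: h h2 L2; lia.
Qed.

Lemma setcol_shell R : setcol (bowtie_shell R) (4 + 4 * (4 * (om R).+1 ^ 4)).
Proof.
have := colU (col_card K) (@col_bigcup _ _ K _ _ (fun v _ => setcol_nbhd_bowtie v R)).
rewrite K4; apply: col_sub => //; apply: setUS; apply/subsetP => y.
rewrite inE => /andP[yR /existsP[L /andP[nL L2]]].
have := near_trace y nL.
move=> h; have: 0 < #|[set u in K | adj u y]| by lia.
move=> /card_gt0P[u]; rewrite inE => /andP[uK uy].
by apply/bigcupP; exists u; rewrite // inE yR.
Qed.
End Peeling.

(** All shells share one palette, of a size fixed by [w]. In the first shell that a triangle meets,
    two of its vertices get different colours; if it has only one vertex there, [shell_nbrs_stable]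
    excludes it. *)
Lemma bowtie_peel w R : om R <= w -> exists U g, [/\ U \subset R, om U <= 3,
  {in R :\: U, forall x, g x < 4 + 4 * (4 * w.+1 ^ 4)}
  & triangle_free_classes (R :\: U) g].
Proof.
have [n] := ubnP #|R|; elim: n R => // n IHn R; rewrite ltnS => Rn Rw.
have [small|big] := leqP (om R) 3.
  by exists R, (fun=> 0); split=> // x y z; rewrite setDv inE.
have [K0 [K0R cK0 K0w]] := om_witness R; rewrite -K0w in big.
have [K KK0 K4] := exists_subset_card big. 
have KR := subset_trans KK0 K0R; have cK := clique_sub KK0 cK0.
have /card_gt0P[u0 u0K] : 0 < #|K| by rewrite K4.
pose B := bowtie_shell K R.
have lt : #|R :\: B| < n.
  apply: leq_trans Rn; apply: proper_card; apply/properP; split; first exact: subsetDl.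
  by exists u0; rewrite ?(subsetP KR) // !inE u0K.
have RBw : om (R :\: B) <= w := leq_trans (om_sub (subsetDl _ _)) Rw.
have [U [g [UR U3 gw gt]]] := IHn _ lt RBw.
have [k kw kp] := setcol_shell cK K4 R.
exists U, (fun x => if x \in B then k x else g x); split=> //.
- exact: subset_trans UR (subsetDl _ _).
- move=> x /setDP[xR xU]; case: ifP => [/kw xk|/negbT xB]; last by apply: gw; apply/setDP; split=> //; apply/setDP.
  by apply: leq_trans xk _; rewrite leq_add2l !leq_mul2l leq_expl ?orbT.
have st x z y := @shell_nbrs_stable K cK K4 R x z y.
have inD x : x \in R :\: U -> x \notin B -> x \in R :\: B.
  by move=> /setDP[xR _] xB; apply/setDP.
have inDU x : x \in R :\: U -> x \notin B -> x \in R :\: B :\: U.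
  by move=> /setDP[xR xU] xB; apply/setDP; split=> //; apply/setDP.
move=> x y z xR yR zR xy xz yz.
case: ifP => [xB|/negbT xB]; case: ifP => [yB|/negbT yB].
- by move=> e; case: (kp x y xB yB xy).
- case: ifP => [zB|/negbT zB]; first by move=> _; apply: kp xz.
  by have := st x y z xB (inD y yR yB) (inD z zR zB) xy xz; rewrite yz.
- case: ifP => [zB|/negbT zB]; last first.
    have := st y x z yB (inD x xR xB) (inD z zR zB).
    by rewrite adj_sym xy yz xz => /(_ isT isT).
  by move=> e1 e2; apply: (kp y z yB zB yz); rewrite -e1 -e2.
- case: ifP => [zB|/negbT zB].
    have := st z x y zB (inD x xR xB) (inD y yR yB).
    by rewrite ![adj z _]adj_sym xy yz xz => /(_ isT isT).
  by apply: gt; rewrite ?inDU.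
Qed.

(** [21 = 4 + 4 * 4 + 1]: each shell colour is refined by [c] colours, and [U] takes [c] more. *)
Lemma setcol_bowtie_free c A : (forall B, om B <= 3 -> setcol B c) ->
  setcol A (21 * c * (om A).+1 ^ 4).
Proof.
move=> hc; have [U [g [UA U3 gN gt]]] := bowtie_peel (leqnn (om A)).
have h2 B : om B <= 2 -> setcol B c by move=> B2; apply: hc; apply: leq_trans B2 _.
have := colU (setcol_triangle_free_classes gN gt h2) (hc U U3).
rewrite setUC setDUK //; apply: col_sub => //.
have : 0 < (om A).+1 ^ 4 by rewrite expn_gt0.
by move: (_ ^ 4) => a; nia.
Qed.
End Bowtie.

Lemma bowtie_free_in_of_induced (G : sgraph) :
  induced_free bowtie G -> bowtie_free_in G.
Proof.
move=> free v a b x y va vb vx vy ab xy [ax ay bx by_].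
pose h (p : mK 2 2) : G := if p.1 == ord0 then (if p.2 == ord0 then a else b)
                           else (if p.2 == ord0 then x else y).
pose f (o : bowtie) : G := if o is Some p then h p else v.
have vh p : adj v (h p) by rewrite /h; case: ifP; case: ifP.
have E := (adj_irr, ab, xy, negPf ax, negPf ay, negPf bx, negPf by_).
have ha p q : adj (h p) (h q) = mK_adj p q.
  case: p q => [[[|[|//]] p1] [[|[|//]] p2]] [[[|[|//]] q1] [[|[|//]] q2]];
  by rewrite /h /mK_adj -!val_eqE /= ?E // adj_sym ?E.
have hi p q : h p = h q -> p = q.
  have nax : a != x by apply: contraNneq ay => ->.
  have nay : a != y by apply: contraNneq ax => ->; rewrite adj_sym.
  have nbx : b != x by apply: contraNneq by_ => ->.
  have nby : b != y by apply: contraNneq bx => ->; rewrite adj_sym.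
  have F (u w : G) : u != w -> ((u == w) = false) * ((w == u) = false).
    by move=> uw; rewrite (negPf uw) eq_sym (negPf uw).
  have N := (F _ _ (adj_neq ab), F _ _ (adj_neq xy), F _ _ nax, F _ _ nay, F _ _ nbx, F _ _ nby).
  case: p q => [[[|[|//]] p1] [[|[|//]] p2]] [[[|[|//]] q1] [[|[|//]] q2]];
  rewrite /h -!val_eqE /= => /eqP; rewrite ?N // => _;
  by congr pair; apply: val_inj.
have fa u w : adj (f u) (f w) = adj u w.
  by case: u w => [p|] [q|] //=; rewrite ?ha ?vh ?adj_irr // adj_sym vh.
apply: (induced_freeE free (f := f)) => // u w e.
case: u w e => [p|] [q|] //= e.
- by rewrite (hi _ _ e).
- by have := vh p; rewrite e adj_irr.
- by have := vh q; rewrite -e adj_irr.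
Qed.

Lemma strongly_pollyanna_bowtie : strongly_pollyanna 3%:Z%R (induced_free bowtie).
Proof.
move=> F /good_col[c hc].
apply: (@poly_chi_bounded_of_col _ (21 * c) 4) => G [/bowtie_free_in_of_induced free FG] A.
by apply: setcol_bowtie_free => // B B3; apply: hc.
Qed.

(** * Substitution *)

Section Zones.
Variables (w c e : nat).
Let d := 3 + c + 2 * e.

(** Left end of the colour interval of level [j], the blocks with clique number above [w / 2 ^ j.+1]
    and at most [w / 2 ^ j]. Interval lengths roughly halve from each level to the next. *)
Definition zone j := w ^ d - w ^ d %/ 2 ^ j.+1.

Lemma zone_le j : zone j <= w ^ d.
Proof. exact: leq_subr. Qed.

Lemma zone_mono i j : i <= j -> zone i <= zone j.
Proof. by move=> ij; rewrite leq_sub2l // leq_div2l ?expn_gt0 // leq_exp2l. Qed.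

(** The choice of [d] comes from here: up to a factor 2 for rounding, the exponent of 2 needed is
    [1 + c + j.+1 * e + j.+1], and this is at most [j * d] for [j >= 1]. *)
Lemma zone_room j : 0 < j ->
  zone j + 2 ^ c * (2 ^ j.+1) ^ e * (w %/ 2 ^ j) ^ d <= zone j.+1.
Proof.
move=> j0; rewrite /zone [2 ^ j.+2]expnSr divnMA.
set F := (w %/ 2 ^ j) ^ d; set y := w ^ d %/ 2 ^ j.+1.
have yw : y <= w ^ d by rewrite leq_div.
suff: 2 * (2 ^ c * (2 ^ j.+1) ^ e * F) <= y by lia.
rewrite leq_divRL ?expn_gt0 //.
have Fw : F * 2 ^ (j * d) <= w ^ d by rewrite expnM -expnMn leq_expl // leq_divM.
apply: leq_trans Fw.
rewrite (_ : _ * _ = F * 2 ^ (1 + c + j.+1 * e + j.+1)); last first.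
  by rewrite -expnM !expnD expn1; lia.
by rewrite leq_mul2l leq_exp2l ?orbT // /d; apply/orP; right; nia.
Qed.

(** [(w - b) ^ d] falls short of [w ^ d] by at least [b * w ^ (d - 1)], which is at least
    [w ^ d / 2 ^ j.+1]. *)
Lemma zone_above b j : b <= w -> w < 2 ^ j.+1 * b -> (w - b) ^ d <= zone j.
Proof.
move=> bw wb; have -> : d = (2 + c + 2 * e).+1 by [].
rewrite /zone -/d (_ : d = (2 + c + 2 * e).+1) // [w ^ _.+1]expnS.
set v := w ^ _; set y := _ %/ _.
have yb : y <= b * v.
  rewrite -(mulKn (b * v) (_ : 0 < 2 ^ j.+1)) ?expn_gt0 // leq_div2r //.
  by rewrite mulnA leq_mul2r (ltnW wb) orbT.
have : (w - b) ^ (2 + c + 2 * e).+1 <= (w - b) * v.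
  by rewrite expnS leq_mul2l leq_expl ?orbT // leq_subr.
rewrite mulnBl; move: (leq_mul bw (leqnn v)) => ?; lia.
Qed.
End Zones.

Section Substitution.
Variable G : sgraph.
Implicit Types (x y z u v h : G) (A B H K L M X : {set G}) (r : G -> G).

Definition mixed z M := [exists a in M, adj z a] && [exists b in M, ~~ adj z b].

Lemma mixedP z M : reflect (exists a b, [/\ a \in M, b \in M, adj z a & ~~ adj z b]) (mixed z M).
Proof.
apply: (iffP andP) => [[/exists_inP[a aM za] /exists_inP[b bM zb]]|[a [b [aM bM za zb]]]].
  by exists a, b.
by split; apply/exists_inP; [exists a|exists b].
Qed.

Lemma not_mixed z M a b : ~~ mixed z M -> a \in M -> b \in M -> adj z a = adj z b.
Proof.
move=> nm aM bM; apply/idP/idP => h; apply: contraR nm => h'; apply/mixedP.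
  by exists a, b.
by exists b, a.
Qed.

(** Primality in the sense of modular decomposition: the only modules are trivial. *)
Definition prime_set H := [forall M : {set G}, (M \proper H) && (1 < #|M|) ==>
  [exists z in H :\: M, mixed z M]].

Lemma prime_setP H : reflect
  (forall M, M \proper H -> 1 < #|M| -> exists2 z, z \in H :\: M & mixed z M)
  (prime_set H).
Proof.
apply: (iffP forallP) => h M.
  by move=> MH M1; apply/exists_inP; have := h M; rewrite MH M1.
by apply/implyP => /andP[MH M1]; apply/exists_inP; apply: h.
Qed.

(* [r] picks a representative in each block of a partition of [A] into
   modules. *)
Definition congruence A r := [/\ {in A, forall x, r x \in A},
  {in A, forall x, r (r x) = r x}
  & {in A &, forall x y, r x != r y -> adj x y = adj (r x) (r y)}].

Lemma congruence_id A : congruence A id.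
Proof. by split. Qed.

(* A partition with the least number (at least 2) of blocks has a prime
   quotient, since a module of the quotient could be merged into one block. *)
Lemma prime_quotient A : 1 < #|A| ->
  exists r, [/\ congruence A r, 1 < #|r @: A| & prime_set (r @: A)].
Proof.
move=> A1.
have [n] := ubnP #|id @: A|.
have: 1 < #|id @: A| by rewrite imset_id.
have := congruence_id A; move: (@id G) => r.
elim: n r => // n IHn r [rA rr rc] H1; rewrite ltnS => Hn.
have [pr|] := boolP (prime_set (r @: A)); first by exists r.
rewrite negb_forall => /existsP[M]; rewrite negb_imply => /andP[/andP[MH M1]].
rewrite negb_exists_in => /forall_inP nm.
have [MH' [h hH hM]] := properP MH.
have [m0 [m1 [m0M m1M m01]]] := card_ge2P M1.
have MA m : m \in M -> m \in A /\ r m = m.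
  by move=> /(subsetP MH')/imsetP[x xA ->]; rewrite rr // rA.
(* The blocks in the module [M] are merged into that of [m0]; [h], outside [M], keeps the number of
   blocks at least 2, and [m1] is no longer a representative. *)
pose r' x := if r x \in M then m0 else r x.
have [m0A rm0] := MA m0 m0M.
have r'm0 : r' m0 = m0 by rewrite /r' rm0 m0M.
have HA y : y \in r @: A -> y \in A /\ r y = y.
  by move=> /imsetP[x xA ->]; rewrite rr // rA.
have [hA rh] := HA h hH.
have r'h : r' h = h by rewrite /r' rh (negPf hM).
apply: (IHn r').
- split.
  + by move=> x xA; rewrite /r'; case: ifP => // _; apply: rA.
  + move=> x xA; rewrite {2 3}/r'; case: ifP => xM; first exact: r'm0.
    by rewrite /r' rr // xM.
  + have key x y : x \in A -> y \in A -> r x \in M -> r y \notin M -> adj x y = adj m0 (r y).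
      move=> xA yA xM yM; rewrite rc //; last by apply: contraNneq yM => <-.
      rewrite ![adj _ (r y)]adj_sym; apply: (not_mixed (nm (r y) _)) => //.
      by rewrite inE yM imset_f.
    move=> x y xA yA; rewrite /r'; case: ifP => xM; case: ifP => yM.
    * by rewrite eqxx.
    * by move=> _; apply: key; rewrite ?yM.
    * by move=> _; rewrite adj_sym key ?xM // adj_sym.
    * by move=> ne; apply: rc.
- have <- : #|[set m0; h]| = 2.
    by rewrite cards2; suff -> : m0 != h by []; apply: contraNneq hM => <-.
  apply/subset_leq_card/subsetP => y /set2P[]->.
    by rewrite -r'm0; apply: imset_f.
  by rewrite -r'h; apply: imset_f.
- apply: leq_trans Hn; apply: proper_card; apply/properP; split.
    apply/subsetP => _ /imsetP[x xA ->]; rewrite /r'; case: ifP => _.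
      exact: (subsetP MH').
    exact: imset_f.
  exists m1; first exact: (subsetP MH').
  apply/imsetP => -[x xA]; rewrite /r'; case: ifP => xM e.
    by rewrite e eqxx in m01.
  by rewrite -e m1M in xM.
Qed.

Section Quotient.
Variables (A : {set G}) (r : G -> G).
Hypothesis rP : congruence A r.
Let block h := [set x in A | r x == h].

(** Maximum cliques of pairwise adjacent blocks unite to one clique. *)
Lemma clique_blocks L : L \subset r @: A -> clique L ->
  \sum_(h in L) om (block h) <= om A.
Proof.
move=> LH cL; have [rA rr rc] := rP.
have /fin_all_exists[K KP] := fun h => om_witness (block h).
pose U := \bigcup_(h in L) K h.
have Kr h x : x \in K h -> x \in A /\ r x = h.
  have [/subsetP KB _ _] := KP h; move=> /KB; rewrite inE => /andP[xA /eqP] //.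
have UA : U \subset A by apply/bigcupsP => h _; apply/subsetP => x /Kr[].
have cU : clique U.
  apply/cliqueP => x y /bigcupP[h hL xh] /bigcupP[k kL yk] ne.
  have [[xA rx] [yA ry]] := (Kr _ _ xh, Kr _ _ yk).
  have [e|ne'] := eqVneq h k.
    by rewrite -e in yk; have [_ /cliqueP cK _] := KP h; apply: cK.
  by rewrite rc ?rx ?ry //; move/cliqueP: cL; apply.
apply: leq_trans (clique_card_le_om UA cU).
rewrite -sum1_card [leqRHS](partition_big r (mem L)) /=; last first.
  by move=> x /bigcupP[h hL /Kr[_ ->]].
apply: leq_sum => h hL; have [_ _ <-] := KP h.
rewrite sum1dep_card subset_leq_card //; apply/subsetP => x xh.
by have [xA rx] := Kr _ _ xh; rewrite inE rx eqxx andbT; apply/bigcupP; exists h.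
Qed.

Variables (c e : nat).
Let d := 3 + c + 2 * e.
Hypothesis hH : forall B, B \subset r @: A -> setcol B (2 ^ c * om B ^ e).
Hypothesis hB : forall h, h \in r @: A -> setcol (block h) (om (block h) ^ d).

(* With [w = om A], a block of clique number [b], [w < 2 ^ j.+1 * b], is
   adjacent only to blocks of clique number at most [w - b].  Blocks with
   [j = 0] are pairwise non-adjacent and are coloured from 0 upwards; the
   others use the interval from [zone j] to [zone j.+1], which lies above all
   colours of the adjacent blocks with [j = 0]. *)
Lemma setcol_quotient : setcol A (om A ^ d).
Proof.
have [rA rr rc] := rP; pose H := r @: A.
pose w := om A; pose W h := om (block h); pose J h := trunc_log 2 (w %/ W h).
have blockP x : x \in A -> x \in block (r x) by move=> xA; rewrite inE xA eqxx.
have rH x : x \in A -> r x \in H by apply: imset_f.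
have W0 h : h \in H -> 0 < W h.
  by move=> /imsetP[x xA ->]; apply: (@om_gt0 _ x); apply: blockP.
have Ww h : W h <= w by apply: om_sub; apply/subsetP => x; rewrite inE => /andP[].
have JP h : h \in H -> 2 ^ J h * W h <= w /\ w < 2 ^ (J h).+1 * W h.
  move=> hH'; have w0 : 0 < w %/ W h by rewrite divn_gt0 ?W0 // Ww.
  have /andP[le lt] := trunc_log_bounds (leqnn 2) w0.
  by rewrite -leq_divRL ?W0 // -ltn_divLR ?W0.
have WW h k : h \in H -> k \in H -> adj h k -> W h + W k <= w.
  move=> hH' kH hk; have := @clique_blocks [set h; k].
  rewrite big_setU1 ?big_set1; last by rewrite inE adj_neq.
  apply; first by apply/subsetP => u /set2P[]->.
  by apply: cliqueU (clique1 _) (clique1 _) _ => _ _ /set1P-> /set1P->.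
pose Hj j := [set h in H | J h == j].
(* Each block of level [j] has clique number above [w / 2 ^ j.+1], and these numbers add up to at
   most [w] along a clique of the quotient. *)
have omHj j : om (Hj j) <= 2 ^ j.+1.
  apply/om_leP => L LH cL; have [w0|w0] := posnP w.
    suff -> : L = set0 by rewrite cards0.
    apply/eqP/set0Pn => -[h /(subsetP LH)]; rewrite inE => /andP[/W0 + _].
    by move: (Ww h); rewrite w0; lia.
  have LH' : L \subset H by apply/subsetP => h /(subsetP LH); rewrite inE => /andP[].
  have := clique_blocks LH' cL; rewrite -/w => hs.
  have : #|L| * w <= 2 ^ j.+1 * w.
    apply: (@leq_trans (2 ^ j.+1 * \sum_(h in L) W h)); last by rewrite leq_mul2l hs orbT.
    rewrite -sum_nat_const [leqRHS]big_distrr /=; apply: leq_sum => h /(subsetP LH).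
    by rewrite inE => /andP[hH' /eqP <-]; have [_ /ltnW] := JP h hH'.
  by rewrite leq_pmul2r.
have /fin_all_exists[kap kapP] : forall j : 'I_w.+1, exists k : G -> nat,
    {in Hj j, forall x, k x < 2 ^ c * (2 ^ j.+1) ^ e} /\
    {in Hj j &, forall x y, adj x y -> k x <> k y}.
  move=> j; have HjH : Hj j \subset H by apply/subsetP => h; rewrite inE => /andP[].
  have [k kl kp] := hH HjH; exists k; split=> // x /kl xk.
  by apply: leq_trans xk _; rewrite leq_mul2l leq_expl ?orbT.
have /fin_all_exists[g gP] : forall h, exists g : G -> nat, h \in H ->
    {in block h, forall x, g x < W h ^ d} /\
    {in block h &, forall x y, adj x y -> g x <> g y}.
  move=> h; have [hH'|_] := boolP (h \in H); last by exists (fun=> 0).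
  by have [g gl gp] := hB hH'; exists g.
pose F j := (w %/ 2 ^ j) ^ d.
have Jw h : h \in H -> J h < w.+1.
  move=> hH'; have [le _] := JP h hH'; rewrite ltnS; apply: leq_trans le.
  by apply: leq_trans (ltnW (ltn_expl _ (leqnn 2))) _; rewrite leq_pmulr ?W0.
pose kp h := kap (inord (J h)) h.
have kpP h : h \in H -> kp h < 2 ^ c * (2 ^ (J h).+1) ^ e.
  move=> hH'; have [/(_ h) + _] := kapP (inord (J h)).
  by rewrite inordK ?Jw //; apply; rewrite inE hH' /=.
have kpp h k : h \in H -> k \in H -> adj h k -> J h = J k -> kp h <> kp k.
  move=> hH' kH hk e'; have [_ /(_ h k)] := kapP (inord (J h)).
  rewrite /kp -e'; apply=> //; by rewrite inE ?hH' ?kH /= inordK ?Jw // e'.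
(* Within a level, a product colouring: a colour of the block in the quotient and a colour inside
   the block. *)
pose f x := let h := r x in
  if J h == 0 then g h x else zone w c e (J h) + (kp h * F (J h) + g h x).
have gF x : x \in A -> g (r x) x < F (J (r x)).
  move=> xA; have [/(_ x (blockP x xA)) + _] := gP _ (rH x xA).
  move/leq_trans; apply; rewrite leq_expl // leq_divRL ?expn_gt0 // mulnC.
  by have [] := JP _ (rH x xA).
have fub x : x \in A -> 0 < J (r x) -> f x < zone w c e (J (r x)).+1.
  move=> xA J0; rewrite /f -if_neg -lt0n J0; apply: leq_trans (zone_room w c e J0).
  rewrite ltn_add2l; apply: (@leq_trans ((kp (r x)).+1 * F (J (r x)))).
    by rewrite mulSn addnC ltn_add2r gF.
  by rewrite leq_mul2r kpP ?orbT // rH.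
exists f => [x xA|x y xA yA].
  have [J0|J0] := posnP (J (r x)); last exact: leq_trans (fub x xA J0) (zone_le _ _ _ _).
  rewrite /f J0 eqxx; have [/(_ x (blockP x xA)) + _] := gP _ (rH x xA).
  by move/leq_trans; apply; rewrite leq_expl.
wlog le : x y xA yA / J (r x) <= J (r y).
  move=> hw; have [|/ltnW le xy] := leqP (J (r x)) (J (r y)); first exact: hw.
  by move=> e'; apply: (hw y x) => //; rewrite adj_sym.
move=> xy; have [exy|nxy] := eqVneq (r x) (r y).
  rewrite /f exy; have [_ /(_ x y)] := gP _ (rH y yA).
  have xb : x \in block (r y) by rewrite -exy blockP.
  move=> /(_ xb (blockP y yA) xy) ne; case: ifP => _ // e'; apply: ne.
  by move: e' => /addnI/addnI.
have hk : adj (r x) (r y) by rewrite -rc.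
have hW := WW _ _ (rH x xA) (rH y yA) hk.
have [_ wx] := JP _ (rH x xA); have [_ wy] := JP _ (rH y yA).
have [Jx0|Jx0] := posnP (J (r x)).
  have [Jy0|Jy0] := posnP (J (r y)).
    by move: wx wy hW; rewrite Jx0 Jy0; lia.
  apply/eqP; rewrite ltn_eqF //; rewrite /f Jx0 eqxx -if_neg -lt0n Jy0.
  have [/(_ x (blockP x xA)) gx _] := gP _ (rH x xA).
  apply: leq_trans gx (leq_trans _ (leq_addr _ _)).
  apply: leq_trans (zone_above c e (Ww (r y)) wy).
  by rewrite leq_expl // leq_subRL ?Ww // addnC.
move: le; rewrite leq_eqVlt => /orP[/eqP eJ|lt]; last first.
  apply/eqP; rewrite ltn_eqF //; apply: leq_trans (fub x xA Jx0) _.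
  apply: leq_trans (zone_mono w c e lt) _.
  by rewrite /f -if_neg -lt0n (leq_trans Jx0 (ltnW lt)) leq_addr.
rewrite /f -eJ eqn0Ngt Jx0 /= => /addnI e'.
apply: (kpp (r x) (r y)) => //; [exact: rH|exact: rH|].
have F0 : 0 < F (J (r x)) by apply: leq_trans (gF x xA).
move: (congr1 (fun n => n %/ F (J (r x))) e').
rewrite !divnMDl // !divn_small ?addn0 //; last by rewrite gF.
by rewrite eJ gF.
Qed.
End Quotient.

(** Recursion on the modular decomposition: the blocks of a prime quotient are smaller than [A].
    Subsets [B] of prime sets enter because the levels are coloured separately. *)
Lemma setcol_of_prime A c e :
  (forall H B, H \subset A -> prime_set H -> B \subset H ->
     setcol B (2 ^ c * om B ^ e)) ->
  setcol A (om A ^ (3 + c + 2 * e)).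
Proof.
have [n] := ubnP #|A|; elim: n A => // n IHn A; rewrite ltnS => An hA.
have [A1|A1] := leqP #|A| 1.
  have [A0|A0] := posnP #|A|; first by move/eqP: A0; rewrite cards_eq0 => /eqP->; apply: col_set0.
  apply: col_sub (subxx _) _ (col_card A); apply: leq_trans A1 _.
  by rewrite expn_gt0; move/card_gt0P: A0 => [x /om_gt0->].
have [r [rP H1 pH]] := prime_quotient A1; have [rA rr rc] := rP.
have HA : r @: A \subset A by apply/subsetP => _ /imsetP[x xA ->]; apply: rA.
apply: (setcol_quotient rP) => [B BH|h hH]; first exact: hA BH.
set b := [set x in A | r x == h].
have bA : b \subset A by apply/subsetP => x; rewrite inE => /andP[].
apply: IHn => [|H B Hb]; last by apply: hA; apply: subset_trans bA.
apply: leq_trans An; apply: proper_card; apply/properP; split=> //.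
have [k [k' [kH kH' ne]]] := card_ge2P H1.
have [y yH yh] : exists2 y, y \in r @: A & y != h.
  by have [e'|e'] := eqVneq k h; [exists k'; rewrite // -e' eq_sym|exists k].
have [x xA ex] := imsetP yH.
by exists x => //; rewrite inE xA -ex.
Qed.
End Substitution.

(** * Bulls *)

Lemma neq_negb (a b : bool) : a != b -> a = ~~ b.
Proof. by case: a; case: b. Qed.

(** * Connectivity and co-connectivity in prime graphs *)

Section RelativeConnectivity.
Variable G : sgraph.
Implicit Types (x y z m : G) (H P Q X Y : {set G}) (s : bool).

(* Connected for [s = true], connected in the complement for [s = false]. *)
Definition rconn s X := forall P : {set G},
  (exists2 a, a \in X & a \in P) -> (exists2 b, b \in X & b \notin P) ->
  exists a b, [/\ a \in X, b \in X, a \in P, b \notin P & adj a b = s].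

Lemma rconn_add s X z x : rconn s X -> x \in X -> adj z x = s ->
  rconn s (z |: X).
Proof.
move=> cX xX zx P [a aX aP] [b bX bP].
have X1 u : u \in X -> u \in z |: X by apply: setU1r.
have [/exists_inP[a' a'X a'P]|nP] := boolP [exists u in X, u \in P].
  have [/exists_inP[b' b'X b'P]|nQ] := boolP [exists u in X, u \notin P].
    have [||u [v [uX vX uP vP uv]]] := cX P; [by exists a'|by exists b'|].
    by exists u, v; split; rewrite ?X1.
  have XP u : u \in X -> u \in P.
    by move=> uX; apply: contraNT nQ => uP; apply/exists_inP; exists u.
  have bz : b = z by move: bX bP => /setU1P[//|/XP->].
  by exists x, z; split; rewrite ?setU11 ?X1 -?bz // ?XP // bz adj_sym.
have XP u : u \in X -> u \notin P.
  by move=> uX; apply: contra nP => uP; apply/exists_inP; exists u.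
have az : a = z by move: aX aP => /setU1P[//|/XP/negPf->].
by exists z, x; split; rewrite ?setU11 ?X1 -?az // ?XP // az.
Qed.

Lemma rconn_pair s x y : adj x y = s -> rconn s [set x; y].
Proof.
move=> xy P [a /set2P ha aP] [b /set2P hb bP].
have ne : a != b by apply: contraNneq bP => <-.
exists a, b; split; rewrite ?inE //.
- by case: ha => ->; rewrite eqxx ?orbT.
- by case: hb => ->; rewrite eqxx ?orbT.
- by case: ha hb ne => -> [] -> //; rewrite ?eqxx // adj_sym.
Qed.

Lemma rconn_mixed s X z : rconn s X -> mixed z X ->
  exists p q, [/\ p \in X, q \in X, adj z p, ~~ adj z q & adj p q = s].
Proof.
move=> cX /mixedP[a [b [aX bX za zb]]].
have [||p [q [pX qX]]] := cX [set u | adj z u].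
- by exists a; rewrite ?inE.
- by exists b; rewrite ?inE.
by rewrite !inE => zp zq pq; exists p, q.
Qed.

Definition split_set X :=
  [exists Q : {set G}, clique Q && [forall x in X :\: Q, forall y in X :\: Q, ~~ adj x y]].

Lemma split_setI X Q : clique Q -> stable (X :\: Q) -> split_set X.
Proof.
move=> cQ sX; apply/existsP; exists Q; rewrite cQ; apply/forall_inP => x xX.
by apply/forall_inP => y yX; apply: sX.
Qed.

(** If a cut had no pair of kind [s], each side would be a module, hence have at most one vertex,
    and [X] would be split. *)
Lemma prime_rconn s X : prime_set X -> ~~ split_set X -> rconn s X.
Proof.
move=> /prime_setP pX nsX P [a aX aP] [b bX bP].
have [/existsP[u /existsP[v /and5P[uX vX uP vP /eqP uv]]]|no] := boolP
    [exists u, exists v, [&& u \in X, v \in X, u \in P, v \notin P & adj u v == s]].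
  by exists u, v.
have {}no u v : u \in X -> v \in X -> u \in P -> v \notin P -> adj u v = ~~ s.
  move=> uX vX uP vP; apply: neq_negb; apply: contraNneq no => uv.
  by apply/existsP; exists u; apply/existsP; exists v; rewrite uX vX uP vP uv eqxx.
have small Q : (forall u v, u \in X :&: Q -> v \in X -> v \notin Q -> adj v u = ~~ s) ->
    (exists2 v, v \in X & v \notin Q) -> #|X :&: Q| <= 1.
  move=> hom [v vX vQ]; rewrite leqNgt; apply/negP => big.
  have pr : X :&: Q \proper X.
    by apply/properP; split; [apply: subsetIl|exists v; rewrite // inE vX].
  have [z] := pX _ pr big.
  rewrite !inE negb_and => /andP[+ zX]; rewrite zX /= => zQ.
  by move=> /mixedP[p [q [pQ qQ zp]]]; rewrite (hom q z) // -(hom p z) // zp.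
exfalso; apply: (negP nsX); apply: (@split_setI X (X :&: P)).
  have : #|X :&: P| <= 1.
    apply: small; last by exists b.
    by move=> u v; rewrite inE => /andP[uX uP] vX vP; rewrite adj_sym no.
  move=> /card_le1_eqP h; apply/cliqueP => x y xX yX; by rewrite (h x y xX yX) eqxx.
have : #|X :&: ~: P| <= 1.
  apply: small; last by exists a; rewrite // inE negbK.
  by move=> u v; rewrite !inE negbK => /andP[uX uP] vX vP; rewrite no.
move=> /card_le1_eqP h x y; rewrite setDIr setDv set0U => xX yX.
by rewrite (h x y) ?adj_irr // -setDE.
Qed.

(* Otherwise a maximal [rconn s] set of vertices on this side would be a
   module. *)
Lemma prime_trace s X m : prime_set X ->
  (exists2 q, q \in X & adj m q = ~~ s) ->
  (forall p p' q, p \in X -> p' \in X -> q \in X -> adj m p = s -> adj m p' = s ->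
     adj m q = ~~ s -> adj p p' = s -> adj p q -> adj p' q) ->
  {in X &, forall p p', adj m p = s -> adj m p' = s -> p != p' -> adj p p' = ~~ s}.
Proof.
move=> /prime_setP pX [q0 q0X mq0] hom p p' pX' p'X mp mp' ne.
apply: neq_negb; apply/eqP => pp'.
pose C := [set x in X | adj m x == s].
suff step n Y : #|C :\: Y| < n -> p \in Y -> p' \in Y -> Y \subset C -> rconn s Y -> False.
  apply: (step _ [set p; p'] (leqnn _)); rewrite ?inE ?eqxx ?orbT //.
    by apply/subsetP => x /set2P[]->; rewrite inE ?pX' ?p'X ?mp ?mp' eqxx.
  exact: rconn_pair.
elim: n Y => // n IHn Y; rewrite ltnS => Yn pY p'Y YC cY.
have YX : Y \subset X by apply: subset_trans YC _; apply/subsetP => x; rewrite inE => /andP[].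
have YM x : x \in Y -> adj m x = s by move=> /(subsetP YC); rewrite inE => /andP[_ /eqP].
have [||z] := pX Y.
- apply/properP; split=> //; exists q0 => //; apply/negP => /YM; rewrite mq0.
  by case: (s).
- have <- : #|[set p; p']| = 2 by rewrite cards2 ne.
  by apply/subset_leq_card/subsetP => x /set2P[]->.
move=> /setDP[zX zY] zm.
have [a [b [aY bY za zb ab]]] := rconn_mixed cY zm.
(* By [hom], a vertex of [X] outside [C] cannot separate [a] from [b]; so [z] lies in [C] and can be
   added to [Y]. *)
have [zs|zs] := eqVneq (adj m z) s; last first.
  have := hom a b z (subsetP YX _ aY) (subsetP YX _ bY) zX (YM a aY) (YM b bY).
  move=> /(_ (neq_negb zs) ab); rewrite adj_sym za => /(_ isT).
  by rewrite adj_sym (negPf zb).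
have [x xY zx] : exists2 x, x \in Y & adj z x = s.
  by case: (s); [exists a|exists b; rewrite ?(negPf zb)].
apply: (IHn (z |: Y)); rewrite ?inE ?pY ?p'Y ?orbT //.
- apply: leq_trans Yn; apply: proper_card; apply/properP; split.
    by apply: setDS; apply: subsetUr.
  by exists z; rewrite !inE ?eqxx ?zX ?zs ?eqxx ?(negPf zY).
- by rewrite subUset sub1set YC inE zX zs eqxx.
- exact: rconn_add zx.
Qed.
End RelativeConnectivity.

(** * Centres and anticentres in prime bull-free graphs *)

Section Bull.
Variable G : sgraph.
Implicit Types (t s w x y z u v : G) (A B D H K L P Q R S X Y : {set G}).

(** In positive form: if all pairs but [d], [e] are as in a bull, then [d] and [e] are adjacent. *)
Definition bull_free_in := forall a b c d e : G,
  adj a b -> adj a c -> adj b c -> adj a d -> adj b e ->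
  ~~ adj c d -> ~~ adj c e -> ~~ adj b d -> ~~ adj a e -> adj d e.

Hypothesis free : bull_free_in.

Section CentreAnticentre.
Variables (X : {set G}) (s : G).
Hypotheses (X_prime : prime_set X) (X_nonsplit : ~~ split_set X).
Hypothesis sX : {in X, forall x, ~~ adj s x}.

(** If [s] were adjacent to [y], bulls through [w] would make the non-neighbours of [y] in [X] a
    clique, and bulls through [s] its neighbours there a stable set; [X] would be split. *)
Lemma mixed_nonadj_anticentre w y : {in X, forall x, adj w x} -> ~~ adj w y ->
  mixed y X -> ~~ adj s y.
Proof.
move=> wX wy yX; apply/negP => sy; apply: (negP X_nonsplit).
have /mixedP[p0 [q0 [p0X q0X yp0 yq0]]] := yX.
apply: (@split_setI _ X [set x in X | ~~ adj y x]).
  apply/cliqueP => q q'; rewrite !inE => /andP[qX yq] /andP[q'X yq'].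
  apply: (@prime_trace _ false X y); rewrite ?(negPf yq) ?(negPf yq') //.
    by exists p0.
  move=> {q q' qX q'X yq yq'} q q' p qX q'X pX /negbT yq /negbT yq' yp /negbT qq' qp.
  apply/negPn/negP => q'p.
  suff: adj q' y by rewrite adj_sym (negPf yq').
  by apply: (free (a := w) (b := p) (c := q)) => //; rewrite ?wX // adj_sym.
move=> p p'; rewrite !inE !negb_and !negbK => /andP[+ pX] /andP[+ p'X].
rewrite pX p'X /= => yp yp'; have [->|ne] := eqVneq p p'; first by rewrite adj_irr.
suff -> : adj p p' = ~~ true by [].
apply: (@prime_trace _ true X y) => //; first by exists q0; rewrite // (negPf yq0).
move=> {p p' pX p'X yp yp' ne} p p' q pX p'X qX yp yp' /negbT yq pp' pq.
apply/negPn/negP => p'q; suff: adj s q by rewrite (negPf (sX qX)).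
by apply: (free (a := y) (b := p) (c := p')) => //; rewrite adj_sym // sX.
Qed.

(** The vertices added to [X] are listed latest first, each mixed on [X] together with those added
    before it. *)
Fixpoint mixing_chain (l : seq G) :=
  if l is y :: l' then mixed y (X :|: [set z in l']) && mixing_chain l' else true.

Lemma in_setU_seq (l : seq G) z :
  (z \in X :|: [set u in l]) = (z \in X) || (z \in l).
Proof. by rewrite !inE. Qed.

Lemma setU_cons (l : seq G) z :
  X :|: [set u in z :: l] = z |: (X :|: [set u in l]).
Proof. by apply/setP => u; rewrite !inE orbCA. Qed.

Lemma mixing_chain_rconn c l : mixing_chain l -> rconn c (X :|: [set z in l]).
Proof.
elim: l => [_|z l IHl /= /andP[zl /IHl cl]].
  rewrite (_ : X :|: _ = X); first exact: prime_rconn.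
  by apply/setP => u; rewrite !inE orbF.
rewrite setU_cons; have /mixedP[a [b [aX bX za zb]]] := zl.
by case: c {IHl} cl => cl; [apply: (rconn_add cl aX)|apply: (rconn_add cl bX (negbTE zb))].
Qed.

(** If [y] is adjacent to the newest [z], take non-adjacent [a], [b] from the earlier set with [z]
    adjacent to [a] only: [w], [z], [a] with [b] and [y] form a bull. *)
Lemma anticomplete_chain l w y : mixing_chain l ->
  {in X :|: [set z in l], forall z, adj w z} -> ~~ adj w y ->
  {in X, forall x, ~~ adj y x} -> {in X :|: [set z in l], forall z, ~~ adj y z}.
Proof.
elim: l => [|z l IHl] /=.
  by move=> _ _ _ yX z; rewrite in_setU_seq orbF; apply: yX.
move=> /andP[zl cl] wl wy yX.
have wl' u : u \in X :|: [set z in l] -> adj w u.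
  by move=> ul; apply: wl; rewrite setU_cons setU1r.
have yl := IHl cl wl' wy yX.
move=> u; rewrite setU_cons => /setU1P[->|]; last exact: yl.
apply/negP => yz.
have [a [b [al bl za zb ab]]] := rconn_mixed (mixing_chain_rconn false cl) zl.
suff: adj b y by rewrite adj_sym (negPf (yl b bl)).
have wz : adj w z by apply: wl; rewrite setU_cons setU11.
have [wa wb] := (wl' a al, wl' b bl); have [ya yb] := (yl a al, yl b bl).
by apply: (free (a := w) (b := z) (c := a)); rewrite ?(negbT ab) // adj_sym.
Qed.

Lemma last_nonadj (l : seq G) y : ~~ all (adj y) l ->
  exists z l1 l2, [/\ l = l1 ++ z :: l2, ~~ adj y z & {in l2, forall u, adj y u}].
Proof.
elim: l => [//|z l IHl]; have [all_l|nall] := boolP (all (adj y) l).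
  by rewrite /= all_l andbT => yz; exists z, [::], l; split=> //; apply/allP.
by move=> _; have [u [l1 [l2 [-> yu h]]]] := IHl nall; exists u, (z :: l1), l2.
Qed.

(* Unrolling the induction, [w] and the successive [y]'s induce a path in the
   complement, and non-adjacency to [s] propagates along it towards [w]. *)
Lemma chain_anticentre l w y : mixing_chain (y :: l) ->
  {in X :|: [set z in l], forall z, adj w z} -> ~~ adj w y ->
  [/\ ~~ adj s w, ~~ adj s y & exists2 x, x \in X & adj y x].
Proof.
have [n] := ubnP (size l); elim: n l w y => // n IHn l w y; rewrite ltnS => ln.
move=> /= /andP[yl cl] wl wy.
have wX : {in X, forall x, adj w x} by move=> x xX; apply: wl; rewrite in_setU_seq xX.
have [yX|nyX] := boolP (mixed y X).
  have sy := mixed_nonadj_anticentre wX wy yX.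
  have [p [q [pX qX yp yq pq]]] := rconn_mixed (prime_rconn true X_prime X_nonsplit) yX.
  split=> //; last by exists p.
  apply/negP => sw; apply: (negP sy); rewrite adj_sym.
  have [wp wq] := (wX p pX, wX q qX); have [sp sq] := (sX pX, sX qX).
  by apply: (free (a := p) (b := w) (c := q)) => //; rewrite adj_sym.
have X0 : exists x, x \in X.
  apply/set0Pn; apply: contraNneq X_nonsplit => ->.
  by apply: (@split_setI _ _ set0); [apply: clique0|move=> u v; rewrite !inE].
have [x0 x0X] := X0.
have hom x : x \in X -> adj y x = adj y x0 by move=> xX; apply: not_mixed nyX xX x0X.
have [yx0|yx0] := boolP (adj y x0); last first.
  have yX : {in X, forall x, ~~ adj y x} by move=> x /hom ->.
  have /mixedP[a [b [al _ ya _]]] := yl.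
  by have := anticomplete_chain cl wl wy yX al; rewrite ya.
have yX : {in X, forall x, adj y x} by move=> x /hom ->.
(* Now [y] is complete to [X] and, with [z] its earliest added non-neighbour, to [l2]. So [y] takes
   over the role of [w] for the chain [z :: l2]. *)
have [z [l1 [l2 [el yz yl2]]]] : exists z l1 l2, [/\ l = l1 ++ z :: l2, ~~ adj y z & {in l2, forall u, adj y u}].
  apply: last_nonadj; apply/negP => /allP all_l.
  have /mixedP[a [b [_ + _ /negP[]]]] := yl; rewrite in_setU_seq.
  by case/orP => [/yX|/all_l].
have cz : mixing_chain (z :: l2).
  by move: cl; rewrite el; elim: (l1) => //= u l1' IH /andP[_ /IH].
have [||sy sz [x xX zx]] := IHn l2 y z _ cz _ yz.
- by apply: leq_trans ln; rewrite el size_cat /= addnS ltnS leq_addl.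
- by move=> u; rewrite in_setU_seq => /orP[/yX|/yl2].
split=> //; last by exists x0.
apply/negP => sw; apply: (negP sy).
have wz : adj w z by apply: wl; rewrite in_setU_seq el mem_cat mem_head !orbT.
have [wx yx sx] := And3 (wX x xX) (yX x xX) (sX xX).
by apply: (free (a := w) (b := x) (c := z)) => //; rewrite adj_sym.
Qed.
End CentreAnticentre.

(** Otherwise [X] grows within the neighbourhood of [t]: primality of [A] yields a vertex mixed on
    the current set, and it is adjacent to [t], since [chain_anticentre] with [w = t] would
    contradict [adj t s]. Finiteness of [A] ends this. *)
Lemma prime_centre_anticentre_split A X t s : prime_set A -> X \subset A ->
  prime_set X -> t \in A -> adj t s -> {in X, forall x, adj t x} ->
  {in X, forall x, ~~ adj s x} -> split_set X.
Proof.
move=> /prime_setP pA XA pX tA ts tX sX; have [//|nsX] := boolP (split_set X); exfalso.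
have X2 : 1 < #|X|.
  rewrite ltnNge; apply/negP => /card_le1_eqP h; apply: (negP nsX).
  apply: (@split_setI _ X set0); first exact: clique0.
  by move=> x y; rewrite setD0 => xX yX; rewrite (h x y) ?adj_irr.
suff step n l : #|A :\: (X :|: [set z in l])| < n -> mixing_chain X l ->
    X :|: [set z in l] \subset A -> {in X :|: [set z in l], forall z, adj t z} -> False.
  apply: (step _ [::] (leqnn _)) => //.
    by rewrite subUset XA; apply/subsetP => u; rewrite inE.
  by move=> u; rewrite in_setU_seq orbF; apply: tX.
elim: n l => // n IHn l; rewrite ltnS => ln cl lA tl.
have [||z /setDP[zA zl] zm] := pA (X :|: [set z in l]).
- by apply/properP; split=> //; exists t => //; apply/negP => /tl; rewrite adj_irr.
- by apply: leq_trans X2 _; apply: subset_leq_card; apply: subsetUl.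
have cz : mixing_chain X (z :: l) by rewrite /= zm.
have [tz|tz] := boolP (adj t z); last first.
  have [] := chain_anticentre pX nsX sX cz tl tz.
  by rewrite adj_sym ts.
apply: (IHn (z :: l)) => //.
- apply: leq_trans ln; apply: proper_card; apply/properP; rewrite setU_cons; split.
    by apply: setDS; apply: subsetUr.
  by exists z; rewrite in_setD ?zA ?zl // setU11.
- by rewrite setU_cons subUset sub1set zA.
- by move=> u; rewrite setU_cons => /setU1P[->|/tl].
Qed.

Lemma setcol_split A B : split_set A -> B \subset A -> setcol B (2 * om B).
Proof.
move=> /existsP[Q /andP[cQ sA]] BA.
have [->|[x xB]] := set_0Vmem B; first exact: col_set0.
have BQ : setcol (B :\: Q) 1.
  exists (fun=> 0) => // u v /setDP[uB uQ] /setDP[vB vQ] uv.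
  move/forall_inP: sA => /(_ u); rewrite inE uQ (subsetP BA) // => /(_ isT).
  by move/forall_inP => /(_ v); rewrite inE vQ (subsetP BA) // uv => /(_ isT).
have := colU (col_card (B :&: Q)) BQ; rewrite setID; apply: col_sub => //.
rewrite mul2n -addnn leq_add ?(om_gt0 xB) //.
by apply: clique_card_le_om; [apply: subsetIl|apply: clique_sub cQ; apply: subsetIr].
Qed.

(** Split sets give [c = e = 1] in [setcol_of_prime], and [6 = 3 + 1 + 2 * 1]. *)
Lemma setcol_centre_anticentre A D t s : prime_set A -> D \subset A -> t \in A ->
  adj t s -> {in D, forall x, adj t x} -> {in D, forall x, ~~ adj s x} ->
  setcol D (om D ^ 6).
Proof.
move=> pA DA tA ts tD sD; apply: (@setcol_of_prime _ D 1 1) => H B HD pH.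
apply: setcol_split; apply: (@prime_centre_anticentre_split A H t s) => //.
- exact: subset_trans DA.
- by move=> x /(subsetP HD)/tD.
- by move=> x /(subsetP HD)/sD.
Qed.
End Bull.

(** * Colouring bull-free graphs *)

Section BullPeeling.
Variable G : sgraph.
Implicit Types (t s x y z u v : G) (A B D K L R S : {set G}).
Hypothesis free : bull_free_in G.

Definition non_nbrs K x := [set u in K | ~~ adj u x].

Lemma touches_non_nbrs K x : touches K x = (non_nbrs K x != K).
Proof.
apply/exists_inP/idP => [[u uK ux]|ne].
  by apply/eqP => e; move: uK; rewrite -e inE ux andbF.
have nK : non_nbrs K x \subset K by apply/subsetP => u; rewrite inE => /andP[].
have /subsetPn[u uK] : ~~ (K \subset non_nbrs K x).
  by apply: contra ne => Kn; rewrite eqEsubset nK.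
by rewrite inE uK /= negbK; exists u.
Qed.

Section Classes.
Variables (R K : {set G}).
Hypotheses (KR : K \subset R) (cK : clique K) (Kw : #|K| = om R).

(* Two vertices with incomparable, intersecting sets of non-neighbours in [K]
   are adjacent, since otherwise they form a bull with a triangle of [K]. *)
Lemma incomparable_non_nbrs_adj x y u : #|non_nbrs K x| = #|non_nbrs K y| ->
  u \in non_nbrs K x -> u \in non_nbrs K y -> non_nbrs K x != non_nbrs K y ->
  adj x y.
Proof.
move=> eS ux uy ne.
have nsub (P Q : {set G}) : #|P| = #|Q| -> P != Q -> exists2 a : G, a \in Q & a \notin P.
  move=> e; rewrite eq_sym => ne'; apply/subsetPn; apply: contra ne' => QP.
  by rewrite eqEcard QP e leqnn.
have [a ay ax] := nsub _ _ eS ne.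
have [b bx by_] : exists2 a : G, a \in non_nbrs K x & a \notin non_nbrs K y.
  by apply: nsub; rewrite // eq_sym.
move: ux uy ay ax bx by_; rewrite !inE.
move=> /andP[uK ux] /andP[_ uy] /andP[aK ay].
rewrite aK /= negbK => ax /andP[bK bx]; rewrite bK /= negbK => by_.
have /cliqueP hK := cK.
apply: (free (a := a) (b := b) (c := u)) => //; apply: hK => //.
- by apply: contraNneq bx => <-.
- by apply: contraNneq ux => <-.
- by apply: contraNneq uy => <-.
Qed.

(** Fix a common element [u] and a size: representatives of distinct sets are then pairwise
    adjacent, so there are at most [om R = #|K|] of them. *)
Lemma card_non_nbrs_classes :
  #|[set non_nbrs K x | x in R]| <= #|K| * #|K|.+1 * #|K|.
Proof.
set Fam := [set _ | x in R].
have [R0|[x0 x0R]] := set_0Vmem R; first by rewrite /Fam R0 imset0 cards0.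
pose F (p : G * 'I_#|K|.+1) := [set S in Fam | (p.1 \in S) && (#|S| == p.2)].
have FamF : Fam \subset \bigcup_(p in setX K setT) F p.
  apply/subsetP => _ /imsetP[x xR ->].
  have [u uK ux] := max_clique_nonadj KR cK Kw xR.
  have lt : #|non_nbrs K x| < #|K|.+1.
    by rewrite ltnS subset_leq_card //; apply/subsetP => v; rewrite inE => /andP[].
  apply/bigcupP; exists (u, Ordinal lt); first by rewrite !inE uK.
  by rewrite inE imset_f //= inE uK ux eqxx.
apply: leq_trans (subset_leq_card FamF) _.
have := @card_bigcup_le _ _ (setX K [set: 'I_#|K|.+1]) F #|K|.
rewrite cardsX cardsT card_ord; apply=> -[u n] _.
have /fin_all_exists[rep repP] : forall S, exists x, S \in Fam -> x \in R /\ non_nbrs K x = S.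
  move=> S; have [/imsetP[x xR ->]|_] := boolP (S \in Fam); first by exists x.
  by exists x0.
have FP S : S \in F (u, n) -> [/\ rep S \in R, non_nbrs K (rep S) = S, u \in S & #|S| = n].
  by rewrite inE /= => /and3P[/repP[rR rS] uS /eqP].
have rep_inj : {in F (u, n) &, injective rep}.
  by move=> S S' /FP[_ eS _ _] /FP[_ eS' _ _] e; rewrite -eS e eS'.
rewrite -(card_in_imset rep_inj) [leqRHS]Kw; apply: clique_card_le_om.
  by apply/subsetP => _ /imsetP[S /FP[rR _ _ _] ->].
apply/cliqueP => _ _ /imsetP[S /FP[_ eS uS nS] ->] /imsetP[S' /FP[_ eS' uS' nS'] ->] ne.
apply: (@incomparable_non_nbrs_adj _ _ u); rewrite ?eS ?eS' ?nS ?nS' //.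
by apply: contraNneq ne => ->.
Qed.

(** The vertices with one given set of non-neighbours, other than all of [K], have a centre [t] and
    an anticentre [s] in [K]; [s] exists because [K] is maximum. *)
Lemma setcol_touching A : prime_set A -> R \subset A ->
  setcol [set x in R | touches K x] (#|K| * #|K|.+1 * #|K| * #|K| ^ 6).
Proof.
move=> pA RA.
pose F S := [set x in R | (non_nbrs K x == S) && (S != K)].
have colF : {in [set non_nbrs K x | x in R], forall S, setcol (F S) (#|K| ^ 6)}.
  move=> _ /imsetP[x xR ->].
  have [eK|neK] := eqVneq (non_nbrs K x) K.
    rewrite (_ : F _ = set0); first exact: col_set0.
    by apply/setP => y; rewrite !inE eK eqxx !andbF.
  have [s sK sx] := max_clique_nonadj KR cK Kw xR.
  move: (neK); rewrite -touches_non_nbrs => /exists_inP[t tK tx].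
  have FP y : y \in F (non_nbrs K x) -> non_nbrs K y = non_nbrs K x.
    by rewrite inE => /and3P[_ /eqP].
  have FR : F (non_nbrs K x) \subset R by apply/subsetP => y; rewrite inE => /andP[].
  have := @setcol_centre_anticentre G free A (F (non_nbrs K x)) t s pA.
  move=> /(_ (subset_trans FR RA) (subsetP (subset_trans KR RA) t tK)) h.
  apply: col_sub (subxx _) _ (h _ _ _).
  - by rewrite leq_expl // Kw om_sub.
  - move/cliqueP: cK; apply=> //; by apply: contraNneq sx => <-.
  - move=> y /FP e; have : t \notin non_nbrs K x by rewrite inE tx andbF.
    by rewrite -e inE tK /= negbK.
  - move=> y /FP e; have : s \in non_nbrs K x by rewrite inE sK.
    by rewrite -e inE => /andP[].
apply: col_sub (col_bigcup colF); last first.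
  by rewrite leq_mul2r card_non_nbrs_classes orbT.
apply/subsetP => x; rewrite inE => /andP[xR]; rewrite touches_non_nbrs => xK.
by apply/bigcupP; exists (non_nbrs K x); rewrite ?imset_f // inE xR eqxx.
Qed.
End Classes.

Definition bull_shell w := w + w * w.+1 * w * w ^ 6.

(** Let [a] in [K] be a neighbour of [x]. If [yz] is an edge, the bull on [x], [y], [z] with [a] and
    [u] forces [x] to be adjacent to each neighbour [u] of [y] in [L]; then the bull on [x], [v],
    [y] forces the rest of [L]. So [x] would extend the maximum clique [L]. *)
Lemma bull_cross_triangle R K L x y z : K \subset R -> clique K -> #|K| = om R ->
  L \subset R -> clique L -> #|L| = #|K| -> {in K & L, forall a u, ~~ adj a u} ->
  x \in R -> touches K x -> ~~ touches K y -> ~~ touches K z ->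
  touches L y -> ~~ touches L z -> adj x y -> adj x z -> ~~ adj y z.
Proof.
move=> KR cK Kw LR cL LK KL xR /exists_inP[a aK ax] /touchesPn Ky /touchesPn Kz.
move=> /exists_inP[v vL vy] /touchesPn Lz xy xz; apply/negP => yz.
have [ay az] := (Ky a aK, Kz a aK).
have nbr u : u \in L -> adj u y -> adj x u.
  move=> uL uy; apply/negPn/negP => xu; have [uz au] := (Lz u uL, KL a u aK uL).
  apply: (negP au); apply: (free (a := x) (b := y) (c := z)) => //; by rewrite adj_sym.
have xv := nbr v vL vy.
have xL u : u \in L -> adj x u.
  move=> uL; have [/nbr-/(_ uL)//|uy] := boolP (adj u y).
  apply/negPn/negP => xu; have [au av] := (KL a u aK uL, KL a v aK vL).
  have vu : adj v u.
    by move/cliqueP: cL; apply=> //; apply: contraTneq vy => ->.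
  apply: (negP au); apply: (free (a := x) (b := v) (c := y)) => //; by rewrite adj_sym.
have xnL : x \notin L by apply/negP => /xL; rewrite adj_irr.
have: #|x |: L| <= om R.
  apply: clique_card_le_om; first by rewrite subUset sub1set xR.
  by apply: cliqueU (clique1 x) cL _ => _ u /set1P-> /xL.
by rewrite cardsU1 xnL LK Kw ltnn.
Qed.

(* The vertices touching a maximum clique [K] of the remaining graph are removed
   together and labelled with [#|K|]; an edge inside a class remembers the
   clique that separates its ends. *)
Lemma bull_peel A w R : prime_set A -> R \subset A -> om R <= w ->
  exists n k : G -> nat, [/\ {in R, forall x, n x <= w}, {in R, forall x, k x < bull_shell w},
    {in R &, forall y z, adj y z -> n y = n z -> k y = k z ->
      exists L, [/\ L \subset R, clique L, #|L| = n y & touches L y (+) touches L z]}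
    & {in R & &, forall x y z, adj x y -> adj x z -> adj y z ->
        n x = n y -> k x = k y -> n x = n z -> k x <> k z}].
Proof.
move=> pA; have [m] := ubnP #|R|; elim: m R => // m IHm R; rewrite ltnS => Rm RA Rw.
have [->|[x0 x0R]] := set_0Vmem R.
  by exists (fun=> 0), (fun=> 0); split=> x; rewrite inE.
have [K [KR cK Kw]] := om_witness R.
have /card_gt0P[u0 u0K] : 0 < #|K| by rewrite Kw; apply: om_gt0 x0R.
pose B := K :|: [set x in R | touches K x].
have BR : B \subset R.
  by rewrite subUset KR; apply/subsetP => x; rewrite inE => /andP[].
have RB x : x \in R -> x \notin B -> x \in R :\: B by move=> xR xB; apply/setDP.
have outK x : x \in R :\: B -> ~~ touches K x.
  by rewrite !inE => /andP[+ xR]; rewrite xR negb_or => /andP[].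
have lt : #|R :\: B| < m.
  apply: leq_trans Rm; apply: proper_card; apply/properP; split; first exact: subsetDl.
  by exists u0; rewrite ?(subsetP KR) // !inE u0K.
have w' := leq_trans (om_sub (subsetDl R B)) Rw.
have [n [k [nw kw edge tri]]] := IHm _ lt (subset_trans (subsetDl _ _) RA) w'.
have [f fB fp] := colU (col_card K) (setcol_touching KR cK Kw pA RA).
pose n' x := if x \in B then #|K| else n x; pose k' x := if x \in B then f x else k x.
have BE : K :|: [set x in R | touches K x] = B by [].
rewrite BE in fB fp.
have cross x y : x \in B -> y \in R :\: B -> adj x y -> touches K x.
  move=> xB yR xy; case/setUP: xB; last by rewrite inE => /andP[].
  by move=> xK; have /touchesPn/(_ x xK) := outK y yR; rewrite xy.
have RK L : L \subset R :\: B -> {in K & L, forall a u, ~~ adj a u}.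
  by move=> LR a u aK /(subsetP LR)/outK/touchesPn; apply.
(* An edge [yz] inside a class is separated by a clique [L]. The shared label makes [#|L| = #|K|],
   so [bull_cross_triangle] applies. *)
have cross_tri x y z : x \in B -> y \in R :\: B -> z \in R :\: B ->
    adj x y -> adj x z -> adj y z -> #|K| = n y -> #|K| = n z -> k y <> k z.
  move=> xB yR zR xy xz yz ny nz kyz; have xK := cross x y xB yR xy.
  have xR := subsetP BR x xB.
  have [|L [LR cL Ln tL]] := edge y z yR zR yz _ kyz; first by rewrite -ny.
  have LR' := subset_trans LR (subsetDl _ _); rewrite -ny in Ln.
  have key := bull_cross_triangle KR cK Kw LR' cL Ln (RK L LR) xR xK.
  have [Ly|Ly] := boolP (touches L y); have [Lz|Lz] := boolP (touches L z).
  - by rewrite Ly Lz in tL.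
  - by have := key y z (outK y yR) (outK z zR) Ly Lz xy xz; rewrite yz.
  - by have := key z y (outK z zR) (outK y yR) Lz Ly xz xy; rewrite adj_sym yz.
  - by rewrite (negPf Ly) (negPf Lz) in tL.
exists n', k'; split.
- move=> x xR; rewrite /n'; case: ifP => [_|/negbT xB]; first by rewrite Kw.
  by apply: nw; apply: RB.
- move=> x xR; rewrite /k'; case: ifP => [xB|/negbT xB]; last by apply: kw; apply: RB.
  apply: leq_trans (fB x xB) _; rewrite Kw /bull_shell leq_add // leq_mul ?leq_expl //.
  by rewrite leq_mul // leq_mul.
- move=> y z yR zR yz; rewrite /n' /k'.
  case: ifP => [yB|/negbT yB]; case: ifP => [zB|/negbT zB].
  + by move=> _ e; case: (fp y z yB zB yz).
  + move=> _ _; exists K; split=> //.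
    have zRB := RB z zR zB; by rewrite (cross y z) // (negPf (outK z zRB)).
  + move=> e _; exists K; split=> //.
    have yRB := RB y yR yB; rewrite adj_sym in yz.
    by rewrite (cross z y) // (negPf (outK y yRB)).
  + move=> en ek; have [L [LR cL Ln tL]] := edge y z (RB y yR yB) (RB z zR zB) yz en ek.
    by exists L; split=> //; apply: subset_trans LR (subsetDl _ _).
- move=> x y z xR yR zR xy xz yz; rewrite /n' /k'.
  case: ifP => [xB|/negbT xB]; case: ifP => [yB|/negbT yB]; case: ifP => [zB|/negbT zB].
  + by move=> _ e; case: (fp x y xB yB xy).
  + by move=> _ e; case: (fp x y xB yB xy).
  + by move=> _ _ _; apply: fp xz.
  + move=> ny ky nz kz.
    by apply: (cross_tri x y z xB (RB y yR yB) (RB z zR zB)); rewrite // -ky -kz.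
  + by move=> _ e _ e'; apply: (fp y z yB zB yz); rewrite -e -e'.
  + move=> nx kx nz; rewrite adj_sym in xy.
    apply: (cross_tri y x z yB (RB x xR xB) (RB z zR zB)) => //; by rewrite -nx.
  + move=> nx kx nz kz; rewrite adj_sym in xz; rewrite adj_sym in yz.
    apply: (cross_tri z x y zB (RB x xR xB) (RB y yR yB)) => //; by rewrite -nz.
  + by apply: tri; try exact: RB.
Qed.

Lemma setcol_bull_prime A B c : prime_set A -> B \subset A ->
  (forall D, om D <= 2 -> setcol D c) ->
  setcol B (2 ^ (6 * c) * om B ^ 10).
Proof.
move=> pA BA hc; have [B0|B0] := posnP (om B); first by rewrite (om_eq0 B0); apply: col_set0.
set w := om B in B0 *.
have [n [k [nw kw _ tri]]] := bull_peel pA BA (leqnn (om B)); rewrite -/w in nw kw.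
have q0 : 0 < bull_shell w by rewrite /bull_shell addn_gt0 B0.
pose g x := n x * bull_shell w + k x.
have gE x y : x \in B -> y \in B -> g x = g y -> n x = n y /\ k x = k y.
  move=> xB yB e; split.
    move: (congr1 (fun i => i %/ bull_shell w) e).
    by rewrite /g !divnMDl // !divn_small ?addn0 ?kw.
  move: (congr1 (fun i => i %% bull_shell w) e).
  by rewrite /g !modnMDl !modn_small ?kw.
have gN : {in B, forall x, g x < w.+1 * bull_shell w}.
  move=> x xB; apply: (@leq_trans ((n x).+1 * bull_shell w)).
    by rewrite /g mulSn addnC ltn_add2r kw.
  by rewrite leq_mul2r ltnS nw ?orbT.
have gt : triangle_free_classes B g.
  move=> x y z xB yB zB xy xz yz /(gE x y xB yB)[nxy kxy] /(gE x z xB zB)[nxz kxz].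
  exact: (tri x y z).
apply: col_sub (subxx _) _ (setcol_triangle_free_classes gN gt hc).
(* [setcol_of_prime] expects a power of 2 as factor; the 6 comes from [w.+1 <= 2 * w] and
   [bull_shell w <= 3 * w ^ 9]. *)
have c6 : 6 * c <= 2 ^ (6 * c) by apply: ltnW; apply: ltn_expl.
have w9 : w <= w ^ 9 by rewrite -{1}(expn1 w) leq_pexp2l.
have e9 : w ^ 9 = w * w * w * w ^ 6 by rewrite !expnS -!mulnA.
have sh : bull_shell w <= 3 * w ^ 9.
  by move: w9; rewrite /bull_shell e9; move: (w ^ 6) => b; nia.
have total : w.+1 * bull_shell w <= 6 * w ^ 10.
  apply: leq_trans (leq_mul (leqnn _) sh) _; rewrite [w ^ 10]expnS.
  by move: (w ^ 9) => b; nia.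
apply: leq_trans (leq_mul total (leqnn c)) _.
by rewrite mulnAC leq_mul2r c6 orbT.
Qed.

Lemma setcol_bull_free A c : (forall D, om D <= 2 -> setcol D c) ->
  setcol A (om A ^ (3 + 6 * c + 2 * 10)).
Proof.
move=> hc; apply: setcol_of_prime => H B _ pH BH; exact: setcol_bull_prime BH hc.
Qed.
End BullPeeling.

Lemma bull_free_in_of_induced (G : sgraph) :
  induced_free bull G -> bull_free_in G.
Proof.
move=> free a b c d e ab ac bc ad be cd ce bd ae; apply/negPn/negP => de.
pose f (i : bull) : G := nth a [:: a; b; c; d; e] i.
have E := (adj_irr, ab, ac, bc, ad, be, negPf cd, negPf ce, negPf bd, negPf ae, negPf de).
have fa i j : adj (f i) (f j) = adj i j.
  case: i j => [[|[|[|[|[|//]]]]] pi] [[|[|[|[|[|//]]]]] pj];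
  by rewrite /f /= ?E // adj_sym ?E.
have N (u v z : G) : adj u z -> ~~ adj v z -> ((u == v) = false) * ((v == u) = false).
  move=> uz vz; have uv : u != v by apply: contraNneq vz => <-.
  by rewrite (negPf uv) eq_sym (negPf uv).
have M (u v : G) : adj u v -> ((u == v) = false) * ((v == u) = false).
  by move=> /adj_neq uv; rewrite (negPf uv) eq_sym (negPf uv).
apply: (induced_freeE free (f := f)) => // i j /eqP.
have ncd : ((c == d) = false) * ((d == c) = false) by apply: (N c d b); rewrite adj_sym // (negPf bd).
have nce : ((c == e) = false) * ((e == c) = false) by apply: (N c e a); rewrite adj_sym // (negPf ae).
have nbd : ((b == d) = false) * ((d == b) = false) by apply: (N b d c); rewrite // adj_sym.
have nae : ((a == e) = false) * ((e == a) = false) by apply: (N a e c); rewrite // adj_sym.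
have nde : ((d == e) = false) * ((e == d) = false) by apply: (N d e a); rewrite adj_sym.
have F := (M _ _ ab, M _ _ ac, M _ _ bc, M _ _ ad, M _ _ be, ncd, nce, nbd, nae, nde).
case: i j => [[|[|[|[|[|//]]]]] pi] [[|[|[|[|[|//]]]]] pj];
by rewrite /f /= ?F // => _; apply: val_inj.
Qed.

Lemma strongly_pollyanna_bull : strongly_pollyanna 2%:Z%R (induced_free bull).
Proof.
move=> F /good_col[c hc].
apply: (@poly_chi_bounded_of_col _ 1 (3 + 6 * c + 2 * 10)) => G [/bull_free_in_of_induced free FG] A.
have h2 (B : {set G}) : om B <= 2 -> setcol B c by move=> B2; apply: hc.
apply: col_sub (subxx _) _ (setcol_bull_free free A h2).
by rewrite mul1n leq_expl.
Qed.

Theorem theorem1p2 (m k t : nat)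
    (hm : (0 < m)%N) (hk : (0 < k)%N) (ht : (0 < t)%N) :
  [/\ strongly_pollyanna (t%:Z - 1)%R (induced_free (mK m t)),
      strongly_pollyanna (2 * t%:Z - 4)%R (induced_free (pineapple t k)),
      strongly_pollyanna (3 * t%:Z - 6)%R (induced_free (lollipop t)),
      strongly_pollyanna 3%:Z (induced_free bowtie)
    & strongly_pollyanna 2%:Z (induced_free bull)].
Proof.
split.
- exact: strongly_pollyanna_mK.
- exact: strongly_pollyanna_pineapple.
- exact: strongly_pollyanna_lollipop.
- exact: strongly_pollyanna_bowtie.
- exact: strongly_pollyanna_bull.
Qed.
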